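(* Let $q>0$ and $d\in\mathbb{C}$ with $|d|>1$, and suppose that $$\varphi(z)=\frac{(1+q+qd)z+(d-q-qd)}{z+d}$$ maps the unit disk $\mathbb{D}$ into itself and is not an automorphism of $\mathbb{D}$. Then $\|C_\varphi\|=\|C_\varphi\|_e$ if and only if $d>1$ (that is, $d$ is real and greater than $1$).
   Context: $\mathbb{D}=\{z\in\mathbb{C}:|z|<1\}$. $H^2$ is the Hardy space of holomorphic functions on $\mathbb{D}$ with square-summable Taylor coefficients at $0$, with inner product $\langle\sum a_jz^j,\sum b_jz^j\rangle=\sum a_j\overline{b_j}$. For holomorphic $\varphi:\mathbb{D}\to\mathbb{D}$, $C_\varphi:H^2\to H^2$ is the (bounded) composition operator $C_\varphi f=f\circ\varphi$, $\|C_\varphi\|$ is its operator norm, and $\|C_\varphi\|_e=\inf\{\|C_\varphi+K\|: K \text{ a compact operator on } H^2\}$ is its essential norm. An automorphism of $\mathbb{D}$ is a holomorphic bijection of $\mathbb{D}$ onto itself. The map $\varphi$ displayed satisfies $\varphi(1)=1$ and $\varphi'(1)=q$; every non-affine linear fractional self-map of $\mathbb{D}$ fixing $1$ has this form. *)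

(* Defs.v *)
From Stdlib Require Import Reals Lra Lia FunctionalExtensionality ProofIrrelevance.
From Stdlib Require Import ClassicalEpsilon.
From Coquelicot Require Import Coquelicot.
Open Scope R_scope.

Definition disk (z : C) : Prop := Cmod z < 1.

Definition holomorphic_on_disk (f : C -> C) : Prop :=
  forall z : C, disk z -> ex_derive f z.

Definition disk_self_map (f : C -> C) : Prop :=
  forall z : C, disk z -> disk (f z).

Definition disk_automorphism (f : C -> C) : Prop :=
  holomorphic_on_disk f /\
  disk_self_map f /\
  (forall z w : C, disk z -> disk w -> f z = f w -> z = w) /\
  (forall w : C, disk w -> exists z : C, disk z /\ f z = w).

(** ** The Hardy space *)

(** A function on the disk is represented by its extension by [0] to [C], so
    that Leibniz equality in [H2] is equality on the disk.  The coefficients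
    are uniquely determined by the function (uniqueness of power series). *)
Record H2 := mkH2 {
  H2_fun :> C -> C;
  H2_coef : nat -> C;
  H2_out : forall z : C, ~ disk z -> H2_fun z = RtoC 0;
  H2_holo : holomorphic_on_disk H2_fun;
  H2_taylor : forall z : C, disk z ->
    is_pseries (K := C_AbsRing) (V := C_NormedModule) H2_coef z (H2_fun z);
  H2_sq_summable : ex_series (fun n => Cmod (H2_coef n) ^ 2)
}.

(** Coquelicot's [Series] is real-valued, hence the two components. *)
Definition H2_inner (f g : H2) : C :=
  (Series (fun n => Re (H2_coef f n * Cconj (H2_coef g n))%C),
   Series (fun n => Im (H2_coef f n * Cconj (H2_coef g n))%C)).

Definition H2_norm (f : H2) : R := sqrt (Re (H2_inner f f)).

Lemma H2_ext (f g : H2) :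
  (forall z, f z = g z) -> (forall n, H2_coef f n = H2_coef g n) -> f = g.
Proof.
destruct f as [f a f1 f2 f3 f4], g as [g b g1 g2 g3 g4]; simpl; intros E1 E2.
assert (f = g) by now apply functional_extensionality.
assert (a = b) by now apply functional_extensionality.
subst g b; f_equal; apply proof_irrelevance.
Qed.

Lemma sq_summable_plus (a b : nat -> C) :
  ex_series (fun n => Cmod (a n) ^ 2) -> ex_series (fun n => Cmod (b n) ^ 2) ->
  ex_series (fun n => Cmod (a n + b n)%C ^ 2).
Proof.
intros Ha Hb.
apply (ex_series_le (V := R_CompleteNormedModule) _
  (fun n => 2 * Cmod (a n) ^ 2 + 2 * Cmod (b n) ^ 2)).
- intros n. change (Rabs (Cmod (a n + b n)%C ^ 2)
    <= 2 * Cmod (a n) ^ 2 + 2 * Cmod (b n) ^ 2).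
  rewrite Rabs_pos_eq by apply pow2_ge_0.
  pose proof (Cmod_triangle (a n) (b n)).
  pose proof (Cmod_ge_0 (a n + b n)%C).
  pose proof (pow2_ge_0 (Cmod (a n) - Cmod (b n))).
  assert (Cmod (a n + b n)%C ^ 2 <= (Cmod (a n) + Cmod (b n)) ^ 2)
    by (apply pow_incr; lra).
  nra.
- apply (ex_series_plus (V := R_NormedModule));
    now apply (ex_series_scal_l (V := R_NormedModule)).
Qed.

Lemma sq_summable_scal (c : C) (a : nat -> C) :
  ex_series (fun n => Cmod (a n) ^ 2) ->
  ex_series (fun n => Cmod (c * a n)%C ^ 2).
Proof.
intros Ha.
apply ex_series_ext with (fun n => Cmod c ^ 2 * Cmod (a n) ^ 2).
- intros n; rewrite Cmod_mult; simpl; ring.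
- now apply (ex_series_scal_l (V := R_NormedModule)).
Qed.

Lemma H2_zero_taylor (z : C) :
  is_pseries (K := C_AbsRing) (V := C_NormedModule) (fun _ => RtoC 0) z (RtoC 0).
Proof.
unfold is_pseries, is_series.
apply filterlim_ext with (fun _ : nat => RtoC 0).
- intros n; induction n as [|n IH].
  + rewrite sum_O. symmetry; apply (scal_zero_r (V := C_ModuleSpace)).
  + rewrite sum_Sn, <- IH, (scal_zero_r (V := C_ModuleSpace)).
    symmetry; apply (plus_zero_r (G := C_AbelianGroup)).
- apply filterlim_const.
Qed.

Definition H2_zero : H2.
Proof.
refine (mkH2 (fun _ => RtoC 0) (fun _ => RtoC 0) _ _ _ _).
- reflexivity.
- intros z _; apply (ex_derive_const (V := C_NormedModule)).
- intros z _; apply H2_zero_taylor.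
- apply ex_series_ext with (fun n => 0 * 0 ^ n).
  + intros n; rewrite Cmod_0; simpl; ring.
  + apply (ex_series_scal_l (V := R_NormedModule)).
    apply ex_series_geom; rewrite Rabs_R0; lra.
Defined.

Definition H2_plus (f g : H2) : H2.
Proof.
refine (mkH2 (fun z => (f z + g z)%C)
  (fun n => (H2_coef f n + H2_coef g n)%C) _ _ _ _).
- intros z Hz; rewrite 2!H2_out by exact Hz; apply Cplus_0_l.
- intros z Hz; apply (ex_derive_plus (V := C_NormedModule));
    now apply H2_holo.
- intros z Hz; apply (is_pseries_plus (V := C_NormedModule));
    now apply H2_taylor.
- apply sq_summable_plus; apply H2_sq_summable.
Defined.

Definition H2_scal (c : C) (f : H2) : H2.
Proof.
refine (mkH2 (fun z => (c * f z)%C) (fun n => (c * H2_coef f n)%C) _ _ _ _).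
- intros z Hz; rewrite H2_out by exact Hz; apply Cmult_0_r.
- intros z Hz; destruct (H2_holo f z Hz) as [l Hl].
  exists (scal c l).
  unfold is_derive.
  apply (filterdiff_ext_lin (U := AbsRing_NormedModule C_AbsRing)
    (V := C_NormedModule) _ (fun y : C => scal c (scal y l))).
  + apply (filterdiff_comp' (U := AbsRing_NormedModule C_AbsRing)
      (V := C_NormedModule) (W := C_NormedModule)
      f (scal c) z _ _ Hl).
    apply (filterdiff_linear (U := C_NormedModule) (V := C_NormedModule)).
    apply (is_linear_scal_r (V := C_NormedModule)); exact Cmult_comm.
  + intros y; change (c * (y * l) = y * (c * l))%C; ring.
- intros z Hz; apply (is_pseries_scal (V := C_NormedModule)).
  + apply Cmult_comm.
  + now apply H2_taylor.
- apply sq_summable_scal; apply H2_sq_summable.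
Defined.

Definition H2_opp (f : H2) : H2 := H2_scal (- RtoC 1) f.

Definition H2_AbelianMonoid_mixin : AbelianMonoid.mixin_of H2.
Proof.
apply (AbelianMonoid.Mixin H2 H2_plus H2_zero); intros; apply H2_ext;
  intros; simpl; ring.
Defined.

Canonical H2_AbelianMonoid := AbelianMonoid.Pack H2 H2_AbelianMonoid_mixin H2.

Definition H2_AbelianGroup_mixin : AbelianGroup.mixin_of H2_AbelianMonoid.
Proof.
apply (AbelianGroup.Mixin H2_AbelianMonoid H2_opp); intros; apply H2_ext;
  intros; simpl; ring.
Defined.

Canonical H2_AbelianGroup := AbelianGroup.Pack H2
  (AbelianGroup.Class H2 H2_AbelianMonoid_mixin H2_AbelianGroup_mixin) H2.

Definition H2_ModuleSpace_mixin : ModuleSpace.mixin_of C_Ring H2_AbelianGroup.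
Proof.
apply (ModuleSpace.Mixin C_Ring H2_AbelianGroup H2_scal); intros;
  apply H2_ext; intros; simpl; unfold mult, plus, one; simpl; ring.
Defined.

Canonical H2_ModuleSpace := ModuleSpace.Pack C_Ring H2
  (ModuleSpace.Class C_Ring H2 (AbelianGroup.class H2_AbelianGroup)
     H2_ModuleSpace_mixin) H2.

Lemma H2_norm_sqr (f : H2) : H2_norm f = sqrt (Series (fun n => Cmod (H2_coef f n) ^ 2)).
Proof.
unfold H2_norm, H2_inner; f_equal; apply Series_ext; intros n.
rewrite Cmod2_alt; destruct (H2_coef f n); simpl; ring.
Qed.

Lemma Series_ge_0 (a : nat -> R) :
  (forall n, 0 <= a n) -> ex_series a -> 0 <= Series a.
Proof.
intros Pa Ha; rewrite <- (Rmult_0_l (Series a)), <- Series_scal_l.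
apply Series_le; [|exact Ha]; intros n; specialize (Pa n); lra.
Qed.

Lemma Series_eq_0 (n : nat) (a : nat -> R) :
  (forall n, 0 <= a n) -> ex_series a -> Series a = 0 -> a n = 0.
Proof.
revert a; induction n as [|n IH]; intros a Pa Ha E;
  assert (Ha' : ex_series (fun k => a (S k)))
    by (apply (ex_series_incr_1 (V := R_NormedModule)) in Ha; exact Ha);
  rewrite (Series_incr_1 a Ha) in E;
  pose proof (Pa 0%nat); pose proof (Series_ge_0 _ (fun k => Pa (S k)) Ha').
- lra.
- apply (IH (fun k => a (S k))); [intros k; apply Pa | exact Ha' | lra].
Qed.

Lemma sum_sq_ge_0 (a : nat -> C) : ex_series (fun n => Cmod (a n) ^ 2) ->
  0 <= Series (fun n => Cmod (a n) ^ 2).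
Proof. apply Series_ge_0; intros n; apply pow2_ge_0. Qed.

Lemma H2_norm_triangle (f g : H2) :
  H2_norm (plus f g) <= H2_norm f + H2_norm g.
Proof.
pose proof (sum_sq_ge_0 _ (H2_sq_summable f)) as Pf.
pose proof (sum_sq_ge_0 _ (H2_sq_summable g)) as Pg.
pose proof (sqrt_sqrt _ Pf) as Ef.
pose proof (sqrt_sqrt _ Pg) as Eg.
rewrite <- H2_norm_sqr in Ef, Eg.
assert (Hf : 0 <= H2_norm f) by (rewrite H2_norm_sqr; apply sqrt_pos).
assert (Hg : 0 <= H2_norm g) by (rewrite H2_norm_sqr; apply sqrt_pos).
rewrite (H2_norm_sqr (plus f g)).
set (A := H2_norm f) in *; set (B := H2_norm g) in *.
apply le_epsilon; intros e He.
set (u := A + e / 2); set (v := B + e / 2).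
assert (Hu : 0 < u) by (unfold u; lra); assert (Hv : 0 < v) by (unfold v; lra).
rewrite <- (sqrt_pow2 (A + B + e)) by lra.
apply sqrt_le_1_alt.
apply Rle_trans with ((1 + v / u) * (A * A) + (1 + u / v) * (B * B)).
- rewrite Ef, Eg, <- 2!Series_scal_l, <- Series_plus.
  + apply Series_le.
    * intros n; split; [apply pow2_ge_0|].
      set (x := Cmod (H2_coef f n)); set (y := Cmod (H2_coef g n)).
      pose proof (Cmod_triangle (H2_coef f n) (H2_coef g n)) as T.
      fold x y in T.
      apply Rle_trans with ((x + y) ^ 2).
      -- apply pow_incr; split; [apply Cmod_ge_0 | exact T].
      -- assert (E : (1 + v / u) * x ^ 2 + (1 + u / v) * y ^ 2 - (x + y) ^ 2
                     = (v * x - u * y) ^ 2 / (u * v)) by (field; lra).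
         assert (0 <= (v * x - u * y) ^ 2 / (u * v)).
         { apply Rmult_le_pos; [apply pow2_ge_0|].
           apply Rlt_le, Rinv_0_lt_compat, Rmult_lt_0_compat; assumption. }
         lra.
    * apply (ex_series_plus (V := R_NormedModule));
        apply (ex_series_scal_l (V := R_NormedModule)); apply H2_sq_summable.
  + apply (ex_series_scal_l (V := R_NormedModule)); apply H2_sq_summable.
  + apply (ex_series_scal_l (V := R_NormedModule)); apply H2_sq_summable.
- apply Rle_trans with ((1 + v / u) * (u * u) + (1 + u / v) * (v * v)).
  + apply Rplus_le_compat; apply Rmult_le_compat_l.
    * assert (0 < v / u) by now apply Rdiv_lt_0_compat. lra.
    * apply Rmult_le_compat; unfold u; lra.
    * assert (0 < u / v) by now apply Rdiv_lt_0_compat. lra.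
    * apply Rmult_le_compat; unfold v; lra.
  + apply Req_le; transitivity ((u + v) ^ 2).
    * field; lra.
    * f_equal; unfold u, v; lra.
Qed.

Lemma H2_norm_scal (c : C) (f : H2) :
  H2_norm (scal c f) = Cmod c * H2_norm f.
Proof.
rewrite 2!H2_norm_sqr.
rewrite (Series_ext _ (fun n => Cmod c ^ 2 * Cmod (H2_coef f n) ^ 2)).
- rewrite Series_scal_l, sqrt_mult_alt by apply pow2_ge_0.
  rewrite sqrt_pow2 by apply Cmod_ge_0; reflexivity.
- intros n; change (H2_coef (scal c f) n) with (c * H2_coef f n)%C.
  rewrite Cmod_mult; ring.
Qed.

Lemma H2_norm_eq_0 (f : H2) : H2_norm f = 0 -> f = zero.
Proof.
intros H.
assert (E : forall n, H2_coef f n = RtoC 0).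
{ rewrite H2_norm_sqr in H.
  apply sqrt_eq_0 in H; [|apply sum_sq_ge_0, H2_sq_summable].
  intros n; apply (Series_eq_0 n) in H;
    [|intros k; apply pow2_ge_0 | apply H2_sq_summable].
  apply Cmod_eq_0; pose proof (Cmod_ge_0 (H2_coef f n)); nra. }
apply H2_ext; [|exact E].
intros z; change (H2_fun zero z) with (RtoC 0).
destruct (Rlt_dec (Cmod z) 1) as [Hz|Hz]; [|now apply H2_out].
apply (filterlim_locally_unique (V := C_NormedModule) (F := eventually)
  _ _ _ (H2_taylor f z Hz)).
apply (is_series_ext (V := C_NormedModule)
  (fun k => scal (pow_n (z : C_AbsRing) k) (RtoC 0))).
- intros n; now rewrite E.
- apply H2_zero_taylor.
Qed.

Definition H2_ball (f : H2) (e : R) (g : H2) : Prop := H2_norm (minus g f) < e.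

Definition H2_UniformSpace_mixin : UniformSpace.mixin_of H2.
Proof.
apply (UniformSpace.Mixin H2 H2_zero H2_ball); unfold H2_ball.
- intros f e; rewrite minus_eq_zero.
  assert (E : H2_zero = scal (V := H2_ModuleSpace) (RtoC 0) H2_zero)
    by (apply H2_ext; intros; simpl; ring).
  change (H2_norm H2_zero < e).
  rewrite E, H2_norm_scal, Cmod_0, Rmult_0_l; apply cond_pos.
- intros f g e H.
  replace (minus f g) with (scal (V := H2_ModuleSpace) (- RtoC 1)%C (minus g f)).
  + now rewrite H2_norm_scal, Cmod_m1, Rmult_1_l.
  + apply H2_ext; intros; simpl; ring.
- intros f g h e1 e2 Hfg Hgh.
  replace (minus h f) with (plus (minus h g) (minus g f)).
  + eapply Rle_lt_trans; [apply H2_norm_triangle | lra].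
  + apply H2_ext; intros; simpl; ring.
Defined.

Canonical H2_UniformSpace := UniformSpace.Pack H2 H2_UniformSpace_mixin H2.

Canonical H2_NormedModuleAux := NormedModuleAux.Pack C_AbsRing H2
  (NormedModuleAux.Class C_AbsRing H2 (ModuleSpace.class C_Ring H2_ModuleSpace)
     H2_UniformSpace_mixin) H2.

Definition H2_NormedModule_mixin :
  NormedModule.mixin_of C_AbsRing H2_NormedModuleAux.
Proof.
apply (NormedModule.Mixin C_AbsRing H2_NormedModuleAux H2_norm 1).
- exact H2_norm_triangle.
- intros c f; apply Req_le; exact (H2_norm_scal c f).
- intros f g e H; exact H.
- intros f g e H; rewrite Rmult_1_l; exact H.
- exact H2_norm_eq_0.
Defined.

Canonical H2_NormedModule := NormedModule.Pack C_AbsRing H2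
  (NormedModule.Class C_AbsRing H2
     (NormedModuleAux.class C_AbsRing H2_NormedModuleAux)
     H2_NormedModule_mixin) H2.

(** ** Operators *)

Section Operators.

Context {K : AbsRing} {U V : NormedModule K}.

(** Equal to [p_infty] when [T] is unbounded on the unit ball. *)
Definition op_norm (T : U -> V) : Rbar :=
  Lub_Rbar (fun r => exists x : U, norm x <= 1 /\ r = norm (T x)).

(** [is_linear] includes boundedness. *)
Definition compact_operator (T : U -> V) : Prop :=
  is_linear T /\
  forall x : nat -> U,
    (exists M : R, forall n, norm (x n) <= M) ->
    exists (s : nat -> nat) (y : V),
      (forall n, (s n < s (S n))%nat) /\
      filterlim (fun n => T (x (s n))) eventually (locally y).

(** The infimum runs over the finite values of [op_norm (T + S)]; this does
    not change it, the infimum of the empty set being [p_infty]. *)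
Definition ess_norm (T : U -> V) : Rbar :=
  Glb_Rbar (fun r => exists S : U -> V, compact_operator S /\
    Finite r = op_norm (fun x => plus (T x) (S x))).

End Operators.

(** [comp_op phi f] is the element of [H2] that agrees with [f o phi] on the
    disk; it is unspecified if there is none, which does not happen for a
    holomorphic self-map [phi] of the disk. *)
Definition comp_op (phi : C -> C) (f : H2) : H2 :=
  epsilon (inhabits H2_zero)
    (fun g : H2 => forall z : C, disk z -> g z = f (phi z)).

Definition linfrac (q : R) (d z : C) : C :=
  (((1 + q + q * d) * z + (d - q - q * d)) / (z + d))%C.

(* Main.v *)
Require Import Defs.
From Stdlib Require Import Reals Lra Lia Psatz Arith ClassicalEpsilon.
From Coquelicot Require Import Coquelicot.
Open Scope R_scope.

(** Write [phi] for [linfrac q d] and [C] for the composition operator.  Then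
    [phi = 1 - r + r tau], where [tau] is an automorphism of the disk that fixes
    [1] and [r = q |1 + d|^2 / (|d|^2 - 1)] is the radius of the image of [phi];
    that [phi] is a self-map and not an automorphism means that [r < 1].

    The operator [S f = (1 + d) / (z + d) * (f o phi)] has norm at most
    [1 / sqrt q] ([weighted_norm]).  Indeed multiplication [V] by [tau] is an
    isometry whose range is orthogonal to [u = 1 / (z + d)], [S] sends [z^n] to
    [(1 + d) ((1 - r) + r V)^n u], and the orthogonality together with the
    convexity of the square of the norm shows that these vectors form a Bessel
    system ([average_bessel]).  Moreover [C = (z + d) / (1 + d) * S], and [S - C]
    is Hilbert-Schmidt, because
    [||phi g||^2 = ||g||^2 - r (1 - r) ||(1 - tau) g||^2] makes the sum of
    [||(1 - tau) phi^n||^2] telescope.  Hence [||C||_e <= 1 / sqrt q], for every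
    [d] ([ess_norm_comp_le]).

    If [d > 1], then [|z + d| <= 1 + d] on the disk, so that
    [||C|| <= ||S|| <= 1 / sqrt q], whereas [||C||_e >= 1 / sqrt q] because the
    adjoint of [C] sends the reproducing kernel at [p] to the kernel at [phi p],
    and [(1 - |p|^2) / (1 - |phi p|^2)] tends to [1 / q] as [p] tends to [1]
    along the radius ([ess_norm_comp_ge]).

    Conversely, if [||C|| <= 1 / sqrt q], then the kernel of [1 / q - C C^*]
    is positive semidefinite.  Take it at the points of the disk that correspond
    to [T, T^2, T^3, ...] in the right half-plane and let [T] tend to infinity:
    with [beta = (d - 1) / (d + 1)] and [c = Re beta - q] this gives, for all
    complex numbers [x_0, ..., x_n],
    [0 <= (1 - Re beta) |x_0 + ... + x_n|^2 + (c / 2) (|x_0|^2 + ... + |x_n|^2)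
          + 2 Im beta * A], where [A] is twice the signed area swept by the
    path with the edges [x_k].  Long closed square paths force [Im beta = 0],
    long straight paths force [Re beta <= 1] ([comp_norm_bound_beta]), and
    together these mean that [d] is real and greater than [1]. *)

(** * Complex power series *)

Lemma sum_n_Re (a : nat -> C) n : Re (sum_n a n) = sum_n (fun k => Re (a k)) n.
Proof.
induction n as [|n IH]; [now rewrite !sum_O|].
rewrite !sum_Sn, <- IH; reflexivity.
Qed.

Lemma sum_n_Im (a : nat -> C) n : Im (sum_n a n) = sum_n (fun k => Im (a k)) n.
Proof.
induction n as [|n IH]; [now rewrite !sum_O|].
rewrite !sum_Sn, <- IH; reflexivity.
Qed.

Lemma is_series_C (a : nat -> C) (l : C) :
  is_series (V := C_NormedModule) a l <->
  is_series (fun n => Re (a n)) (Re l) /\ is_series (fun n => Im (a n)) (Im l).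
Proof.
split.
- intros H; split; apply filterlim_locally; intros eps;
    destruct (proj1 (filterlim_locally (U := C_UniformSpace) _ _) H eps) as [N HN];
    exists N; intros n Hn; destruct (HN n Hn) as [H1 H2];
    [rewrite <- sum_n_Re | rewrite <- sum_n_Im]; assumption.
- intros [H1 H2]; apply (filterlim_locally (U := C_UniformSpace)); intros eps.
  destruct (proj1 (filterlim_locally _ _) H1 eps) as [N1 HN1].
  destruct (proj1 (filterlim_locally _ _) H2 eps) as [N2 HN2].
  exists (max N1 N2); intros n Hn; split.
  + change (ball (Re l) eps (Re (sum_n a n))); rewrite sum_n_Re; apply HN1; lia.
  + change (ball (Im l) eps (Im (sum_n a n))); rewrite sum_n_Im; apply HN2; lia.
Qed.

Lemma Cconj_RtoC (x : R) : Cconj (RtoC x) = RtoC x.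
Proof. unfold Cconj, RtoC; simpl; now rewrite Ropp_0. Qed.

Lemma im_le_Cmod (c : C) : Rabs (Im c) <= Cmod c.
Proof.
apply Rle_trans with (2 := Rmax_Cmod c), Rmax_r.
Qed.

(** The sum of an absolutely convergent complex series, taken componentwise. *)
Definition CSeries (a : nat -> C) : C :=
  (Series (fun n => Re (a n)), Series (fun n => Im (a n))).

Lemma CSeries_correct (a : nat -> C) :
  ex_series (fun n => Cmod (a n)) ->
  is_series (V := C_NormedModule) a (CSeries a).
Proof.
intros H; apply is_series_C; split; apply Series_correct;
  apply (ex_series_le (V := R_CompleteNormedModule) _ (fun n => Cmod (a n)));
  try exact H; intros n; [apply re_le_Cmod | apply im_le_Cmod].
Qed.

Lemma CSeries_unique (a : nat -> C) (l : C) :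
  is_series (V := C_NormedModule) a l -> CSeries a = l.
Proof.
intros [H1 H2]%is_series_C; unfold CSeries.
rewrite (is_series_unique _ _ H1), (is_series_unique _ _ H2); now destruct l.
Qed.

Lemma CSeries_Cmod_le (a : nat -> C) (b : nat -> R) :
  (forall n, Cmod (a n) <= b n) -> ex_series b -> Cmod (CSeries a) <= Series b.
Proof.
intros H Hb.
assert (Ha : ex_series (fun n => Cmod (a n))).
{ apply (ex_series_le (V := R_CompleteNormedModule) _ b); [|exact Hb].
  intros n; unfold norm; simpl; unfold abs; simpl.
  rewrite Rabs_pos_eq by apply Cmod_ge_0; apply H. }
pose proof (CSeries_correct a Ha) as Hs.
assert (L : is_lim_seq (fun n => Cmod (sum_n a n)) (Cmod (CSeries a))).
{ apply (filterlim_comp _ _ _ (sum_n a) Cmod eventually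
    (locally (T := C_NormedModule) (CSeries a)) (locally (Cmod (CSeries a)))).
  - exact Hs.
  - apply (filterlim_norm (V := C_NormedModule)). }
assert (L' : is_lim_seq (sum_n b) (Series b)) by exact (Series_correct b Hb).
refine (is_lim_seq_le _ _ _ _ _ L L'); intros n.
change (Cmod (sum_n a n)) with (norm (V := C_NormedModule) (sum_n a n)).
unfold sum_n.
apply Rle_trans with (1 := norm_sum_n_m (V := C_NormedModule) a 0 n).
apply sum_n_m_le, H.
Qed.

(** Power series are studied for bounded coefficients: this suffices for
    convergence in the disk and is stable under division by [z - z0]. *)
Definition bounded_seq (a : nat -> C) := exists M, forall n, Cmod (a n) <= M.

Lemma ex_series_pow_bounded (a : nat -> C) (z : C) :
  bounded_seq a -> disk z -> ex_series (fun n => Cmod (a n * z ^ n)).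
Proof.
intros [M HM] Hz.
apply (ex_series_le (V := R_CompleteNormedModule) _ (fun n => M * Cmod z ^ n)).
- intros n; unfold norm; simpl; unfold abs; simpl.
  rewrite Rabs_pos_eq by apply Cmod_ge_0; rewrite Cmod_mult, Cmod_pow.
  apply Rmult_le_compat_r; [apply pow_le, Cmod_ge_0 | apply HM].
- apply (ex_series_scal_l (V := R_NormedModule)), ex_series_geom.
  rewrite Rabs_pos_eq; [exact Hz | apply Cmod_ge_0].
Qed.

(** The value at [z] of the power series with coefficients [a]. *)
Definition pval (a : nat -> C) (z : C) : C := CSeries (fun n => a n * z ^ n)%C.

Lemma pval_correct (a : nat -> C) (z : C) : bounded_seq a -> disk z ->
  is_series (V := C_NormedModule) (fun n => a n * z ^ n)%C (pval a z).
Proof. intros Ha Hz; apply CSeries_correct, ex_series_pow_bounded; assumption. Qed.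

Lemma pow_n_Cpow (z : C) n : pow_n (z : C_AbsRing) n = (z ^ n)%C.
Proof.
induction n as [|n IH]; [reflexivity|].
change (z * pow_n (z : C_AbsRing) n = z * z ^ n)%C; f_equal; exact IH.
Qed.

Lemma is_pseries_C (a : nat -> C) (z l : C) :
  is_pseries (K := C_AbsRing) (V := C_NormedModule) a z l <->
  is_series (V := C_NormedModule) (fun n => a n * z ^ n)%C l.
Proof.
unfold is_pseries; split; apply is_series_ext; intros n;
  [rewrite (pow_n_Cpow z n) | rewrite <- (pow_n_Cpow z n)]; apply Cmult_comm.
Qed.

Lemma pval_bound (a : nat -> C) M (z : C) : (forall n, Cmod (a n) <= M) -> disk z ->
  Cmod (pval a z) <= M / (1 - Cmod z).
Proof.
intros HM Hz.
assert (P := Cmod_ge_0 z).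
unfold disk in Hz.
replace (M / (1 - Cmod z)) with (Series (fun n => M * Cmod z ^ n)).
2: rewrite Series_scal_l, Series_geom; [reflexivity | rewrite Rabs_pos_eq; assumption].
apply CSeries_Cmod_le.
- intros n; rewrite Cmod_mult, Cmod_pow.
  apply Rmult_le_compat_r; [apply pow_le, Cmod_ge_0 | apply HM].
- apply (ex_series_scal_l (V := R_NormedModule)), ex_series_geom.
  rewrite Rabs_pos_eq; assumption.
Qed.

(** Coefficients of the quotient of [pval a z - pval a z0] by [z - z0]. *)
Definition pquot (z0 : C) (a : nat -> C) (n : nat) : C :=
  pval (fun j => a (S (n + j))) z0.

Lemma pquot_bounded (z0 : C) (a : nat -> C) : disk z0 -> bounded_seq a ->
  bounded_seq (pquot z0 a).
Proof.
intros Hz [M HM]; exists (M / (1 - Cmod z0)); intros n.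
apply pval_bound; [intros j; apply HM | exact Hz].
Qed.

Lemma pval_incr (a : nat -> C) z : bounded_seq a -> disk z ->
  pval a z = (a 0%nat + z * pval (fun n => a (S n)) z)%C.
Proof.
intros Ha Hz.
assert (Ha' : bounded_seq (fun n => a (S n))) by (destruct Ha as [M H]; now exists M).
apply CSeries_unique.
apply (is_series_decr_1 (V := C_NormedModule)).
change (is_series (V := C_NormedModule) (fun k => a (S k) * z ^ S k)%C
  (a 0%nat + z * pval (fun n => a (S n)) z + - (a 0%nat * z ^ 0))%C).
replace (a 0%nat + z * pval (fun n => a (S n)) z + - (a 0%nat * z ^ 0))%C
  with (scal z (pval (fun n => a (S n)) z) : C_NormedModule)
  by (unfold scal; simpl; unfold mult; simpl; ring).
apply is_series_ext with (fun n => scal z (a (S n) * z ^ n)%C : C_NormedModule).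
- intros n; unfold scal; simpl; unfold mult; simpl; ring.
- apply (is_series_scal_l (V := C_NormedModule)), pval_correct; assumption.
Qed.

Lemma pval_plus (a b : nat -> C) z : bounded_seq a -> bounded_seq b -> disk z ->
  pval (fun n => a n + b n)%C z = (pval a z + pval b z)%C.
Proof.
intros Ha Hb Hz; apply CSeries_unique.
apply is_series_ext with (fun n => plus (a n * z ^ n)%C (b n * z ^ n)%C : C_NormedModule).
- intros n; unfold plus; simpl; ring.
- apply (is_series_plus (V := C_NormedModule)); apply pval_correct; assumption.
Qed.

Lemma pval_scal (c : C) (a : nat -> C) z : bounded_seq a -> disk z ->
  pval (fun n => c * a n)%C z = (c * pval a z)%C.
Proof.
intros Ha Hz; apply CSeries_unique.
apply is_series_ext with (fun n => scal c (a n * z ^ n)%C : C_NormedModule).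
- intros n; unfold scal; simpl; unfold mult; simpl; ring.
- apply (is_series_scal_l (V := C_NormedModule)); apply pval_correct; assumption.
Qed.

Lemma bounded_scal c a : bounded_seq a -> bounded_seq (fun n => c * a n)%C.
Proof.
intros [M HM]; exists (Cmod c * M); intros n; rewrite Cmod_mult.
apply Rmult_le_compat_l; [apply Cmod_ge_0 | apply HM].
Qed.

Lemma bounded_plus a b : bounded_seq a -> bounded_seq b ->
  bounded_seq (fun n => a n + b n)%C.
Proof.
intros [M HM] [M' HM']; exists (M + M'); intros n.
apply Rle_trans with (1 := Cmod_triangle _ _), Rplus_le_compat; auto.
Qed.

Lemma pval_quot (z0 z : C) (a : nat -> C) : bounded_seq a -> disk z0 -> disk z ->
  pval a z = (pval a z0 + (z - z0) * pval (pquot z0 a) z)%C.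
Proof.
intros Ha Hz0 Hz.
assert (Hq := pquot_bounded z0 a Hz0 Ha).
assert (HS : bounded_seq (fun n => a (S n))) by (destruct Ha as [M H]; now exists M).
assert (HqS : bounded_seq (fun n => pquot z0 a (S n))) by (destruct Hq as [M H]; now exists M).
assert (Rec : forall n, pquot z0 a n = (a (S n) + z0 * pquot z0 a (S n))%C).
{ intros n; unfold pquot; rewrite pval_incr; [|destruct Ha as [M H]; now exists M | exact Hz0].
  rewrite Nat.add_0_r; f_equal; f_equal; unfold pval; apply f_equal2; apply Series_ext; intros j;
  now replace (S (n + S j)) with (S (S n + j)) by lia. }
assert (E : pval (pquot z0 a) z = (pval (fun n => a (S n)) z
              + z0 * pval (fun n => pquot z0 a (S n)) z)%C).
{ rewrite <- pval_scal, <- pval_plus; try assumption.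
  - unfold pval; apply f_equal2; apply Series_ext; intros n; now rewrite Rec.
  - now apply bounded_scal. }
assert (E0 : pval a z0 = (a 0%nat + z0 * pquot z0 a 0%nat)%C)
  by now rewrite pval_incr.
pose proof (pval_incr (pquot z0 a) z Hq Hz) as E1.
rewrite E0, (pval_incr a z Ha Hz).
transitivity (a 0%nat + z0 * (pquot z0 a 0 + z * pval (fun n => pquot z0 a (S n)) z)
   + z * pval (pquot z0 a) z - z0 * pval (pquot z0 a) z - z0 * z * pval (fun n => pquot z0 a (S n)) z)%C.
- rewrite <- E1, E; ring.
- ring.
Qed.

(** Division by [z - z0], applied twice, leaves a remainder that is
    [(z - z0)^2] times a locally bounded function. *)
Lemma pval_derive (a : nat -> C) (z0 : C) : bounded_seq a -> disk z0 ->
  is_derive (K := C_AbsRing) (V := C_NormedModule) (pval a) z0 (pval (pquot z0 a) z0).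
Proof.
intros Ha Hz0.
assert (Hq := pquot_bounded z0 a Hz0 Ha).
destruct (pquot_bounded z0 _ Hz0 Hq) as [M HM].
assert (HM0 : 0 <= M) by (apply Rle_trans with (2 := HM 0%nat), Cmod_ge_0).
split; [apply (is_linear_scal_l (V := C_NormedModule))|].
intros x Hx.
apply (is_filter_lim_locally_unique (V := AbsRing_NormedModule C_AbsRing)) in Hx; subst x.
intros [eps Heps].
unfold disk in Hz0.
set (r := (1 - Cmod z0) / 2).
assert (Hr : 0 < r) by (unfold r; lra).
assert (Hd : 0 < Rmin r (eps * r / (M + 1))).
{ apply Rmin_glb_lt; [exact Hr|].
  apply Rdiv_lt_0_compat; [apply Rmult_lt_0_compat|]; lra. }
exists (mkposreal _ Hd); intros z Hz.
change (Cmod (z - z0)%C < Rmin r (eps * r / (M + 1))) in Hz.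
change (Cmod ((pval a z - pval a z0) - (z - z0) * pval (pquot z0 a) z0)%C
  <= eps * Cmod (z - z0)%C).
assert (H1 := Rlt_le_trans _ _ _ Hz (Rmin_l _ _)).
assert (H2 := Rlt_le_trans _ _ _ Hz (Rmin_r _ _)).
assert (Hz1 : Cmod z <= 1 - r).
{ replace z with (z0 + (z - z0))%C by ring.
  apply Rle_trans with (1 := Cmod_triangle _ _); unfold r in *; lra. }
assert (Hzd : disk z) by (unfold disk; lra).
rewrite (pval_quot z0 z a Ha Hz0 Hzd), (pval_quot z0 z (pquot z0 a) Hq Hz0 Hzd).
set (g := pval (pquot z0 (pquot z0 a)) z).
assert (Hg : Cmod g <= M / r).
{ apply Rle_trans with (1 := pval_bound _ M z HM Hzd).
  apply Rmult_le_compat_l; [exact HM0|]; apply Rinv_le_contravar; lra. }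
match goal with |- Cmod ?u <= _ =>
  replace u with ((z - z0) * ((z - z0) * g))%C by ring end.
rewrite !Cmod_mult, (Rmult_comm eps).
apply Rmult_le_compat_l; [apply Cmod_ge_0|].
apply Rle_trans with (eps * r / (M + 1) * (M / r)).
- apply Rmult_le_compat; try apply Cmod_ge_0; lra.
- replace (eps * r / (M + 1) * (M / r)) with (eps * (M / (M + 1))) by (field; lra).
  rewrite <- (Rmult_1_r eps) at 2; apply Rmult_le_compat_l; [lra|].
  apply Rle_div_l; lra.
Qed.

Lemma function_choice {A B : Type} (P : A -> B -> Prop) :
  (forall a, exists b, P a b) -> exists f, forall a, P a (f a).
Proof.
intros H; exists (fun a => proj1_sig (constructive_indefinite_description _ (H a))).
intros a; apply proj2_sig.
Qed.

(** * Elements of the Hardy space *)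

Lemma sq_le_Series (a : nat -> C) n : ex_series (fun k => Cmod (a k) ^ 2) ->
  Cmod (a n) ^ 2 <= Series (fun k => Cmod (a k) ^ 2).
Proof.
revert a; induction n as [|n IH]; intros a Ha;
  assert (Ha' : ex_series (fun k => Cmod (a (S k)) ^ 2))
    by (apply (ex_series_incr_1 (V := R_NormedModule)) in Ha; exact Ha);
  rewrite (Series_incr_1 _ Ha).
- pose proof (sum_sq_ge_0 _ Ha'); lra.
- pose proof (IH _ Ha'); pose proof (pow2_ge_0 (Cmod (a 0%nat))); lra.
Qed.

Lemma sq_summable_bounded (a : nat -> C) :
  ex_series (fun k => Cmod (a k) ^ 2) -> bounded_seq a.
Proof.
intros Ha; exists (sqrt (Series (fun k => Cmod (a k) ^ 2))); intros n.
rewrite <- (sqrt_pow2 (Cmod (a n))) by apply Cmod_ge_0.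
apply sqrt_le_1_alt, sq_le_Series, Ha.
Qed.

Lemma disk_dec (z : C) : {disk z} + {~ disk z}.
Proof. unfold disk; apply Rlt_dec. Qed.

(** The element of the Hardy space with given Taylor coefficients. *)
Definition H2_of (a : nat -> C) (Ha : ex_series (fun k => Cmod (a k) ^ 2)) : H2.
Proof.
refine (mkH2 (fun z => if disk_dec z then pval a z else RtoC 0) a _ _ _ Ha).
- intros z Hz; destruct (disk_dec z); [contradiction | reflexivity].
- intros z Hz; exists (pval (pquot z a) z).
  apply (is_derive_ext_loc (V := C_NormedModule) (pval a)).
  + assert (Hd : 0 < 1 - Cmod z) by (unfold disk in Hz; lra).
    exists (mkposreal _ Hd); intros y Hy.
    change (Cmod (y - z)%C < 1 - Cmod z) in Hy.
    destruct (disk_dec y) as [|N]; [reflexivity|]; exfalso; apply N; unfold disk.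
    replace y with (z + (y - z))%C by ring.
    pose proof (Cmod_triangle z (y - z)); lra.
  + apply pval_derive; [apply sq_summable_bounded, Ha | exact Hz].
- intros z Hz; destruct (disk_dec z); [|contradiction].
  apply is_pseries_C, pval_correct; [apply sq_summable_bounded, Ha | exact Hz].
Defined.

Lemma H2_bounded (f : H2) : bounded_seq (H2_coef f).
Proof. apply sq_summable_bounded, H2_sq_summable. Qed.

Lemma H2_val (f : H2) z : disk z -> f z = pval (H2_coef f) z.
Proof.
intros Hz; symmetry; apply CSeries_unique, is_pseries_C, H2_taylor, Hz.
Qed.

Lemma disk_0 : disk (RtoC 0).
Proof. unfold disk; rewrite Cmod_0; lra. Qed.

Lemma pval_0 a : bounded_seq a -> pval a (RtoC 0) = a 0%nat.
Proof. intros Ha; rewrite pval_incr by (exact Ha || exact disk_0); ring. Qed.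

(** Uniqueness of the coefficients of a power series. *)
Lemma pval_unique (a : nat -> C) : bounded_seq a ->
  (forall z, disk z -> pval a z = RtoC 0) -> forall n, a n = RtoC 0.
Proof.
intros Ha H n; revert a Ha H; induction n as [|n IH]; intros a Ha H.
- rewrite <- (pval_0 a Ha); apply H, disk_0.
- assert (Hb : bounded_seq (fun n => a (S n))) by (destruct Ha as [M HM]; now exists M).
  apply (IH (fun n => a (S n)) Hb).
  assert (Hnz : forall z, disk z -> z <> RtoC 0 -> pval (fun n => a (S n)) z = RtoC 0).
  { intros z Hz Hz0; pose proof (H z Hz) as E.
    rewrite (pval_incr a z Ha Hz) in E.
    rewrite <- (pval_0 a Ha), (H _ disk_0), Cplus_0_l in E.
    destruct (Ceq_dec (pval (fun n => a (S n)) z) (RtoC 0)) as [|N]; [assumption|].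
    now destruct (Cmult_neq_0 z _ Hz0 N). }
  intros z Hz; destruct (Ceq_dec z (RtoC 0)) as [->|Hz0]; [|now apply Hnz].
  (* the value at 0 is the limit of the values at nearby points *)
  destruct (pquot_bounded (RtoC 0) _ disk_0 Hb) as [M HM].
  assert (HM0 : 0 <= M) by (apply Rle_trans with (2 := HM 0%nat), Cmod_ge_0).
  apply Cmod_eq_0, Rle_antisym; [|apply Cmod_ge_0].
  apply le_epsilon; intros e He; rewrite Rplus_0_l.
  set (t := Rmin (1/2) (e / (2 * M + 1))).
  assert (Ht : 0 < t) by (apply Rmin_glb_lt; [lra | apply Rdiv_lt_0_compat; lra]).
  assert (Ht1 : t <= 1/2) by apply Rmin_l.
  assert (Ht2 : t <= e / (2 * M + 1)) by apply Rmin_r.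
  assert (Hm : Cmod (RtoC t) = t) by (rewrite Cmod_R; apply Rabs_pos_eq; lra).
  assert (Dt : disk (RtoC t)) by (unfold disk; rewrite Hm; lra).
  pose proof (pval_quot (RtoC 0) (RtoC t) _ Hb disk_0 Dt) as E.
  rewrite Hnz in E; [|exact Dt | intros E'; apply RtoC_inj in E'; lra].
  set (g := pval (pquot _ _) (RtoC t)) in E.
  assert (Hg : Cmod g <= 2 * M).
  { apply Rle_trans with (1 := pval_bound _ M _ HM Dt); rewrite Hm.
    rewrite (Rmult_comm 2); apply Rmult_le_compat_l; [exact HM0|].
    replace 2 with (/ (1/2)) by lra; apply Rinv_le_contravar; lra. }
  replace (pval (fun n => a (S n)) (RtoC 0)) with (- (RtoC t * g))%C.
  + rewrite Cmod_opp, Cmod_mult, Hm.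
    apply Rle_trans with (e / (2 * M + 1) * (2 * M)).
    * apply Rmult_le_compat; try apply Cmod_ge_0; lra.
    * replace (e / (2 * M + 1) * (2 * M)) with (e * ((2 * M) / (2 * M + 1))) by (field; lra).
      rewrite <- (Rmult_1_r e) at 2; apply Rmult_le_compat_l; [lra|].
      apply Rle_div_l; lra.
  + match type of E with ?o = (?x + ?y)%C =>
      transitivity (x + y - y)%C; [rewrite <- E|]; ring end.
Qed.

(** Functions of the Hardy space that agree on the disk are equal. *)
Lemma H2_eq (f g : H2) : (forall z, disk z -> f z = g z) -> f = g.
Proof.
intros E; apply H2_ext.
- intros z; destruct (disk_dec z) as [Hz|Hz]; [now apply E|].
  now rewrite !H2_out.
- intros n.
  assert (Bg : bounded_seq (fun n => (- RtoC 1) * H2_coef g n)%C) by apply bounded_scal, H2_bounded.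
  assert (Z : (H2_coef f n + (- RtoC 1) * H2_coef g n)%C = RtoC 0).
  { apply (pval_unique (fun n => H2_coef f n + (- RtoC 1) * H2_coef g n)%C).
    - apply bounded_plus; [apply H2_bounded | exact Bg].
    - intros z Hz; rewrite pval_plus, pval_scal, <- !H2_val, E;
        try assumption; try apply H2_bounded; ring. }
  replace (H2_coef f n) with
    ((H2_coef f n + (- RtoC 1) * H2_coef g n) + H2_coef g n)%C by ring.
  rewrite Z; ring.
Qed.

(** * Norm and inner product *)

Lemma H2_norm_ge_0 (f : H2) : 0 <= H2_norm f.
Proof. apply sqrt_pos. Qed.

Lemma H2_norm2 (f : H2) : H2_norm f ^ 2 = Series (fun n => Cmod (H2_coef f n) ^ 2).
Proof.
rewrite H2_norm_sqr, pow2_sqrt; [reflexivity|].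
apply sum_sq_ge_0, H2_sq_summable.
Qed.

Lemma H2_coef_le (f : H2) n : Cmod (H2_coef f n) <= H2_norm f.
Proof.
rewrite H2_norm_sqr, <- (sqrt_pow2 (Cmod _)) by apply Cmod_ge_0.
apply sqrt_le_1_alt, (sq_le_Series (H2_coef f)), H2_sq_summable.
Qed.

(** Absolute convergence of the series that defines the inner product. *)
Lemma inner_summable (f g : H2) :
  ex_series (fun n => Cmod (H2_coef f n * Cconj (H2_coef g n))%C).
Proof.
apply (ex_series_le (V := R_CompleteNormedModule) _
  (fun n => Cmod (H2_coef f n) ^ 2 + Cmod (H2_coef g n) ^ 2)).
- intros n; unfold norm; simpl; unfold abs; simpl.
  rewrite Rabs_pos_eq by apply Cmod_ge_0; rewrite Cmod_mult, Cmod_conj.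
  pose proof (pow2_ge_0 (Cmod (H2_coef f n) - Cmod (H2_coef g n))).
  pose proof (pow2_ge_0 (Cmod (H2_coef f n) + Cmod (H2_coef g n))).
  simpl in *; lra.
- apply (ex_series_plus (V := R_NormedModule)); apply H2_sq_summable.
Qed.

Lemma inner_correct (f g : H2) : is_series (V := C_NormedModule)
  (fun n => H2_coef f n * Cconj (H2_coef g n))%C (H2_inner f g).
Proof. exact (CSeries_correct _ (inner_summable f g)). Qed.

Lemma inner_plus_l (f g h : H2) :
  H2_inner (plus f g) h = (H2_inner f h + H2_inner g h)%C.
Proof.
apply CSeries_unique.
refine (is_series_ext _ _ _ _
  (is_series_plus (V := C_NormedModule) _ _ _ _ (inner_correct f h) (inner_correct g h))).
intros n; change ((H2_coef f n * Cconj (H2_coef h n) + H2_coef g n * Cconj (H2_coef h n))%C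
  = ((H2_coef f n + H2_coef g n) * Cconj (H2_coef h n))%C); ring.
Qed.

Lemma inner_scal_l (c : C) (f h : H2) :
  H2_inner (scal c f) h = (c * H2_inner f h)%C.
Proof.
apply CSeries_unique.
refine (is_series_ext _ _ _ _
  (is_series_scal_l (V := C_NormedModule) c _ _ (inner_correct f h))).
intros n; change ((c * (H2_coef f n * Cconj (H2_coef h n)))%C
  = ((c * H2_coef f n) * Cconj (H2_coef h n))%C); ring.
Qed.

Lemma inner_conj (f g : H2) : H2_inner g f = Cconj (H2_inner f g).
Proof.
unfold H2_inner, Cconj; simpl; f_equal.
- apply Series_ext; intros n; simpl; ring.
- rewrite <- Series_opp; apply Series_ext; intros n; simpl; ring.
Qed.

Lemma inner_plus_r (f g h : H2) :
  H2_inner h (plus f g) = (H2_inner h f + H2_inner h g)%C.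
Proof.
rewrite inner_conj, inner_plus_l, Cplus_conj; f_equal; symmetry; apply inner_conj.
Qed.

Lemma inner_scal_r (c : C) (f h : H2) :
  H2_inner h (scal c f) = (Cconj c * H2_inner h f)%C.
Proof.
rewrite inner_conj, inner_scal_l, Cmult_conj; f_equal; symmetry; apply inner_conj.
Qed.

Lemma inner_self (f : H2) : H2_inner f f = RtoC (H2_norm f ^ 2).
Proof.
rewrite H2_norm2; unfold H2_inner, RtoC; f_equal.
- apply Series_ext; intros n; rewrite Cmod2_alt; destruct (H2_coef f n); simpl; ring.
- rewrite (Series_ext _ (fun n => 0 * 0)), Series_scal_l; [ring|].
  intros n; destruct (H2_coef f n); simpl; ring.
Qed.

Lemma norm2_plus (f g : H2) :
  H2_norm (plus f g) ^ 2 = H2_norm f ^ 2 + H2_norm g ^ 2 + 2 * Re (H2_inner f g).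
Proof.
assert (E : RtoC (H2_norm (plus f g) ^ 2) =
  (RtoC (H2_norm f ^ 2) + RtoC (H2_norm g ^ 2) + (H2_inner f g + Cconj (H2_inner f g)))%C).
{ rewrite <- !inner_self, inner_plus_l, !inner_plus_r, (inner_conj f g); ring. }
apply (f_equal Re) in E; rewrite re_plus in E.
destruct (H2_inner f g); simpl in *; lra.
Qed.

Lemma norm2_scal (c : C) (f : H2) : H2_norm (scal c f) ^ 2 = Cmod c ^ 2 * H2_norm f ^ 2.
Proof. rewrite H2_norm_scal; ring. Qed.

Lemma Re_inner_le (f g : H2) : Re (H2_inner f g) <= H2_norm f * H2_norm g.
Proof.
pose proof (H2_norm_ge_0 f) as Pf; pose proof (H2_norm_ge_0 g) as Pg.
pose proof (H2_norm_triangle f g) as T.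
pose proof (norm2_plus f g) as E.
assert (H2_norm (plus f g) ^ 2 <= (H2_norm f + H2_norm g) ^ 2)
  by (apply pow_incr; split; [apply H2_norm_ge_0 | exact T]).
nra.
Qed.

Lemma Cauchy_Schwarz (f g : H2) : Cmod (H2_inner f g) <= H2_norm f * H2_norm g.
Proof.
set (v := H2_inner f g).
destruct (Req_dec (Cmod v) 0) as [->|N].
- apply Rmult_le_pos; apply H2_norm_ge_0.
- pose proof (Re_inner_le (scal (Cconj v) f) g) as H.
  rewrite inner_scal_l, H2_norm_scal, Cmod_conj in H; fold v in H.
  rewrite Cmult_comm, <- Cmod2_conj in H.
  change (Cmod v ^ 2 <= Cmod v * H2_norm f * H2_norm g) in H.
  pose proof (Cmod_ge_0 v).
  apply Rmult_le_reg_l with (Cmod v); [lra|]; lra.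
Qed.

(** * Reproducing kernels *)

Lemma kernel_summable (p : C) : disk p -> ex_series (fun n => Cmod (Cconj p ^ n)%C ^ 2).
Proof.
intros Hp; apply ex_series_ext with (fun n => (Cmod p ^ 2) ^ n).
- intros n; rewrite Cmod_pow, Cmod_conj, <- !pow_mult; f_equal; lia.
- apply ex_series_geom; rewrite Rabs_pos_eq by apply pow2_ge_0.
  unfold disk in Hp; pose proof (Cmod_ge_0 p); nra.
Qed.

(** The reproducing kernel [z |-> 1 / (1 - conj p z)] at a point [p] of the disk. *)
Definition kernel (p : C) (Hp : disk p) : H2 :=
  H2_of (fun n => Cconj p ^ n)%C (kernel_summable p Hp).

Lemma reproducing (f : H2) (p : C) (Hp : disk p) : H2_inner f (kernel p Hp) = f p.
Proof.
rewrite (H2_val f p Hp); apply CSeries_unique.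
apply is_series_ext with (fun n => H2_coef f n * p ^ n)%C.
- intros n; simpl; now rewrite Cpow_conj, Cconj_conj.
- apply pval_correct; [apply H2_bounded | exact Hp].
Qed.

Lemma one_minus_neq_0 (u : C) : Cmod u < 1 -> (1 - u)%C <> RtoC 0.
Proof.
intros H E; assert (u = RtoC 1) as -> by (replace u with (1 - (1 - u))%C by ring; rewrite E; ring).
rewrite Cmod_1 in H; lra.
Qed.

Lemma Cmod_mult_lt_1 (u v : C) : disk u -> disk v -> Cmod (Cconj u * v)%C < 1.
Proof.
unfold disk; rewrite Cmod_mult, Cmod_conj; intros Hu Hv.
pose proof (Cmod_ge_0 u); pose proof (Cmod_ge_0 v); nra.
Qed.

Lemma kernel_val (p : C) (Hp : disk p) z : disk z ->
  kernel p Hp z = (/ (1 - Cconj p * z))%C.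
Proof.
intros Hz.
assert (N := one_minus_neq_0 _ (Cmod_mult_lt_1 p z Hp Hz)).
pose proof (pval_incr _ z (H2_bounded (kernel p Hp)) Hz) as E.
rewrite <- H2_val in E by exact Hz.
set (v := kernel p Hp z) in *; simpl in E.
assert (Hv : pval (fun n => Cconj p * Cconj p ^ n)%C z = (Cconj p * v)%C).
{ rewrite pval_scal; [|exact (H2_bounded (kernel p Hp)) | exact Hz].
  f_equal; unfold v; now rewrite H2_val. }
rewrite Hv in E.
transitivity (v * (1 - Cconj p * z) / (1 - Cconj p * z))%C.
- now field.
- replace (v * (1 - Cconj p * z))%C with (v - z * (Cconj p * v))%C by ring.
  rewrite E at 1. field; exact N.
Qed.

Lemma kernel_norm2 (p : C) (Hp : disk p) : H2_norm (kernel p Hp) ^ 2 = / (1 - Cmod p ^ 2).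
Proof.
unfold disk in Hp; pose proof (Cmod_ge_0 p).
rewrite H2_norm2, <- Series_geom.
- apply Series_ext; intros n.
  change (Cmod (Cconj p ^ n)%C ^ 2 = (Cmod p ^ 2) ^ n).
  rewrite Cmod_pow, Cmod_conj, <- !pow_mult; f_equal; lia.
- rewrite Rabs_pos_eq by apply pow2_ge_0; nra.
Qed.

Lemma H2_val_le (f : H2) (p : C) : disk p ->
  Cmod (f p) <= H2_norm f * sqrt (/ (1 - Cmod p ^ 2)).
Proof.
intros Hp; rewrite <- (reproducing f p Hp), <- (kernel_norm2 p Hp).
rewrite sqrt_pow2 by apply H2_norm_ge_0; apply Cauchy_Schwarz.
Qed.

Lemma sq_le_reg (x y : R) : 0 <= y -> x ^ 2 <= y ^ 2 -> x <= y.
Proof. intros Hy H; apply Rnot_lt_le; intros L; nra. Qed.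

(** * Completeness *)

Lemma coef_minus (f g : H2) k : H2_coef (minus f g) k = (H2_coef f k - H2_coef g k)%C.
Proof. change (H2_coef f k + (- (1)) * H2_coef g k = H2_coef f k - H2_coef g k)%C; ring. Qed.

Lemma val_minus (f g : H2) z : minus f g z = (f z - g z)%C.
Proof. change (f z + (- (1)) * g z = f z - g z)%C; ring. Qed.

Lemma val_plus (f g : H2) z : plus f g z = (f z + g z)%C.
Proof. reflexivity. Qed.

Lemma val_scal (c : C) (f : H2) z : scal c f z = (c * f z)%C.
Proof. reflexivity. Qed.

Lemma pos_series_bounded (a : nat -> R) M : (forall n, 0 <= a n) ->
  (forall n, sum_n a n <= M) -> ex_series a /\ Series a <= M.
Proof.
intros Pa HM.
assert (Ex : ex_series a).
{ destruct (ex_finite_lim_seq_incr (sum_n a) M) as [l Hl].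
  - intros n; rewrite sum_Sn; unfold plus; simpl; specialize (Pa (S n)); lra.
  - exact HM.
  - exists l; exact Hl. }
split; [exact Ex|].
assert (L : is_lim_seq (sum_n a) (Series a)) by exact (Series_correct a Ex).
exact (is_lim_seq_le _ _ _ _ HM L (is_lim_seq_const M)).
Qed.

Lemma sum_n_le_Series (a : nat -> R) n : (forall n, 0 <= a n) -> ex_series a ->
  sum_n a n <= Series a.
Proof.
intros Pa Ex.
apply (is_lim_seq_incr_compare (sum_n a)); [exact (Series_correct a Ex)|].
intros k; rewrite sum_Sn; unfold plus; simpl; specialize (Pa (S k)); lra.
Qed.

Lemma is_lim_seq_Cmod (u : nat -> C) (l : C) :
  is_lim_seq (fun m => Cmod (u m - l)%C) 0 -> is_lim_seq (fun m => Cmod (u m)) (Cmod l).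
Proof.
intros H.
apply (is_lim_seq_le_le (fun m => Cmod l - Cmod (u m - l)%C) _
  (fun m => Cmod l + Cmod (u m - l)%C)).
- intros m.
  pose proof (Cmod_triangle (u m - l) l) as T1.
  pose proof (Cmod_triangle (- (u m - l)) (u m)) as T2.
  rewrite Cmod_opp in T2.
  replace (u m - l + l)%C with (u m) in T1 by ring.
  replace (- (u m - l) + u m)%C with l in T2 by ring.
  lra.
- replace (Finite (Cmod l)) with (Finite (Cmod l - 0)) by (f_equal; ring).
  apply is_lim_seq_minus'; [apply is_lim_seq_const | exact H].
- replace (Finite (Cmod l)) with (Finite (Cmod l + 0)) by (f_equal; ring).
  apply is_lim_seq_plus'; [apply is_lim_seq_const | exact H].
Qed.

Lemma is_lim_seq_sum_n (u : nat -> nat -> R) (l : nat -> R) K :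
  (forall k, is_lim_seq (fun m => u m k) (l k)) ->
  is_lim_seq (fun m => sum_n (u m) K) (sum_n l K).
Proof.
intros H; induction K as [|K IH].
- apply is_lim_seq_ext with (fun m => u m 0%nat); [intros m; now rewrite sum_O|].
  rewrite sum_O; apply H.
- apply is_lim_seq_ext with (fun m => sum_n (u m) K + u m (S K));
    [intros m; now rewrite sum_Sn|].
  rewrite sum_Sn; apply is_lim_seq_plus'; auto.
Qed.

(** Coefficientwise limits do not increase a bound on the norm. *)
Lemma coef_limit_bound (x : nat -> H2) (c : nat -> C) (M : R) :
  (forall k, is_lim_seq (fun m => Cmod (H2_coef (x m) k - c k)%C) 0) ->
  eventually (fun m => H2_norm (x m) <= M) ->
  ex_series (fun k => Cmod (c k) ^ 2) /\ Series (fun k => Cmod (c k) ^ 2) <= M ^ 2.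
Proof.
intros Hc HM; apply pos_series_bounded; [intros n; apply pow2_ge_0|].
intros K.
assert (L : is_lim_seq (fun m => sum_n (fun k => Cmod (H2_coef (x m) k) ^ 2) K)
              (sum_n (fun k => Cmod (c k) ^ 2) K)).
{ apply is_lim_seq_sum_n; intros k.
  apply is_lim_seq_ext with (fun m => Cmod (H2_coef (x m) k) * Cmod (H2_coef (x m) k));
    [intros m; ring|].
  replace (Cmod (c k) ^ 2) with (Cmod (c k) * Cmod (c k)) by ring.
  apply is_lim_seq_mult'; apply is_lim_seq_Cmod, Hc. }
refine (is_lim_seq_le_loc _ _ _ _ _ L (is_lim_seq_const (M ^ 2))).
destruct HM as [N HN]; exists N; intros m Hm.
apply Rle_trans with (H2_norm (x m) ^ 2).
- rewrite H2_norm2; apply sum_n_le_Series;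
    [intros n; apply pow2_ge_0 | apply H2_sq_summable].
- apply pow_incr; split; [apply H2_norm_ge_0 | now apply HN].
Qed.

Lemma H2_complete (x : nat -> H2) :
  (forall eps, 0 < eps -> exists N, forall m n, (N <= m)%nat -> (N <= n)%nat ->
     H2_norm (minus (x m) (x n)) <= eps) ->
  exists y : H2, forall eps, 0 < eps -> exists N, forall n, (N <= n)%nat ->
     H2_norm (minus y (x n)) <= eps.
Proof.
intros HC.
assert (Hc : exists c : nat -> C, forall k,
          is_lim_seq (fun m => Cmod (H2_coef (x m) k - c k)%C) 0).
{ apply (function_choice (fun k l => is_lim_seq (fun m => Cmod (H2_coef (x m) k - l)%C) 0)).
  intros k.
  assert (L : exists y : C_CompleteNormedModule,
            filterlim (fun m => H2_coef (x m) k : C_CompleteNormedModule) eventually (locally y)).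
  { apply (filterlim_locally_cauchy (U := C_CompleteNormedModule)).
    intros eps; destruct (HC (eps / 2)) as [N HN]; [apply is_pos_div_2|].
    exists (fun m => (N <= m)%nat); split; [now exists N|].
    intros u v Hu Hv.
    apply C_NormedModule_mixin_compat1.
    change (Cmod (H2_coef (x v) k - H2_coef (x u) k)%C < eps).
    rewrite <- coef_minus.
    apply Rle_lt_trans with (1 := H2_coef_le (minus (x v) (x u)) k).
    apply Rle_lt_trans with (1 := HN v u Hv Hu).
    destruct eps as [e He]; simpl; lra. }
  destruct L as [y Hy]; exists y; apply is_lim_seq_spec; intros eps.
  destruct (proj1 (filterlim_locally_ball_norm (U := C_NormedModule) _ _) Hy eps) as [N HN].
  exists N; intros m Hm; rewrite Rminus_0_r, Rabs_pos_eq by apply Cmod_ge_0.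
  exact (HN m Hm). }
destruct Hc as [c Hc].
assert (D : forall n eps, (exists N, forall m, (N <= m)%nat -> H2_norm (minus (x m) (x n)) <= eps) ->
  ex_series (fun k => Cmod (c k - H2_coef (x n) k)%C ^ 2) /\
  Series (fun k => Cmod (c k - H2_coef (x n) k)%C ^ 2) <= eps ^ 2).
{ intros n eps Hn; apply (coef_limit_bound (fun m => minus (x m) (x n))); [|exact Hn].
  intros k; apply is_lim_seq_ext with (2 := Hc k); intros m; f_equal.
  rewrite coef_minus; ring. }
assert (Sc : ex_series (fun k => Cmod (c k) ^ 2)).
{ destruct (HC 1 Rlt_0_1) as [N HN].
  destruct (D N 1) as [E _]; [exists N; intros m Hm; apply HN; lia|].
  apply ex_series_ext with (2 := sq_summable_plus _ _ E (H2_sq_summable (x N))).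
  intros k; f_equal; f_equal; ring. }
exists (H2_of c Sc); intros eps He.
destruct (HC eps He) as [N HN]; exists N; intros n Hn.
destruct (D n eps) as [_ B]; [exists N; intros m Hm; now apply HN|].
rewrite H2_norm_sqr, <- (sqrt_pow2 eps) by lra; apply sqrt_le_1_alt.
apply Rle_trans with (2 := B), Req_le, Series_ext; intros k; f_equal; f_equal.
now rewrite coef_minus.
Qed.
Lemma norm_minus_sym (f g : H2) : H2_norm (minus f g) = H2_norm (minus g f).
Proof.
replace (minus f g) with (scal (- RtoC 1)%C (minus g f)).
- rewrite H2_norm_scal, Cmod_m1; ring.
- apply H2_eq; intros z _; rewrite val_scal, !val_minus; ring.
Qed.

Lemma norm_le_minus (f g : H2) : H2_norm f <= H2_norm g + H2_norm (minus f g).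
Proof.
replace f with (plus g (minus f g)) at 1.
- apply H2_norm_triangle.
- apply H2_eq; intros z _; rewrite val_plus, val_minus; ring.
Qed.

(** The sum of [scal (a k) (s k)] over [k <= n]. *)
Definition lincomb (a : nat -> C) (s : nat -> H2) (n : nat) : H2 :=
  sum_n (fun k => scal (a k) (s k)) n.

Lemma lincomb_S a s n :
  lincomb a s (S n) = plus (lincomb a s n) (scal (a (S n)) (s (S n))).
Proof. apply (sum_Sn (G := H2_AbelianMonoid)). Qed.

Lemma lincomb_0 a s : lincomb a s 0 = scal (a 0%nat) (s 0%nat).
Proof. apply (sum_O (G := H2_AbelianMonoid)). Qed.

Lemma lincomb_val a s n z : lincomb a s n z = sum_n (fun k => a k * s k z)%C n.
Proof.
induction n as [|n IH]; [now rewrite lincomb_0, sum_O|].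
rewrite lincomb_S, sum_Sn, val_plus, IH; reflexivity.
Qed.

(** A difference of partial sums is a partial sum for truncated coefficients. *)
Lemma lincomb_tail (a : nat -> C) (s : nat -> H2) m k :
  minus (lincomb a s (m + k)) (lincomb a s m) =
  lincomb (fun j => if le_dec j m then RtoC 0 else a j) s (m + k).
Proof.
assert (E0 : forall i, (i <= m)%nat ->
  lincomb (fun j => if le_dec j m then RtoC 0 else a j) s i = zero).
{ induction i as [|i IH]; intros Hi.
  - rewrite lincomb_0; destruct (le_dec 0 m); [|lia]; apply (scal_zero_l (V := H2_ModuleSpace)).
  - rewrite lincomb_S, IH by lia; destruct (le_dec (S i) m); [|lia].
    rewrite plus_zero_l; apply (scal_zero_l (V := H2_ModuleSpace)). }
induction k as [|k IH].
- rewrite Nat.add_0_r, E0 by lia; apply (minus_eq_zero (G := H2_AbelianGroup)).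
- rewrite Nat.add_succ_r, !lincomb_S, <- IH; destruct (le_dec (S (m + k)) m); [lia|].
  apply H2_eq; intros z _; rewrite !val_minus, !val_plus, !val_minus; ring.
Qed.

(** If the synthesis map [a |-> sum a_k s_k] is bounded by [K] on finitely
    supported sequences, it extends to the whole Hardy space. *)
Lemma synthesis (s : nat -> H2) (K : R) : 0 <= K ->
  (forall a n, H2_norm (lincomb a s n) ^ 2 <= K ^ 2 * sum_n (fun k => Cmod (a k) ^ 2) n) ->
  forall f : H2, exists g : H2, H2_norm g <= K * H2_norm f /\
    forall eps, 0 < eps -> exists N, forall n, (N <= n)%nat ->
      H2_norm (minus g (lincomb (H2_coef f) s n)) <= eps.
Proof.
intros HK Hs f.
set (b := fun k => Cmod (H2_coef f k) ^ 2).
assert (Pb : forall k, 0 <= b k) by (intros k; apply pow2_ge_0).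
assert (Tail : forall m k, H2_norm (minus (lincomb (H2_coef f) s (m + k)) (lincomb (H2_coef f) s m)) ^ 2
   <= K ^ 2 * (Series b - sum_n b m)).
{ intros m k; rewrite lincomb_tail.
  apply Rle_trans with (1 := Hs _ _), Rmult_le_compat_l; [apply pow2_ge_0|].
  apply Rle_trans with (sum_n b (m + k) - sum_n b m).
  - assert (E0 : forall i, (i <= m)%nat ->
      sum_n (fun j => Cmod (if le_dec j m then RtoC 0 else H2_coef f j) ^ 2) i = 0).
    { induction i as [|i IH]; intros Hi.
      - rewrite sum_O; destruct (le_dec 0 m); [|lia]; rewrite Cmod_0; change (0 ^ 2 = 0); ring.
      - rewrite sum_Sn, IH by lia; destruct (le_dec (S i) m); [|lia].
        unfold plus; simpl; rewrite Cmod_0; change (0 + 0 * (0 * 1) = 0); ring. }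
    induction k as [|k IH].
    + rewrite Nat.add_0_r, E0 by lia; lra.
    + rewrite Nat.add_succ_r, !sum_Sn; destruct (le_dec (S (m + k)) m); [lia|].
      change (Cmod (H2_coef f (S (m + k))) ^ 2) with (b (S (m + k))).
      unfold plus; simpl; simpl in IH; lra.
  - apply Rplus_le_compat_r, sum_n_le_Series; [exact Pb | apply H2_sq_summable]. }
assert (L : forall eps, 0 < eps -> exists N, forall m, (N <= m)%nat ->
   K ^ 2 * (Series b - sum_n b m) <= eps).
{ intros eps He.
  assert (L : is_lim_seq (fun m => K ^ 2 * (Series b - sum_n b m)) 0).
  { replace (Finite 0) with (Finite (K ^ 2 * (Series b - Series b))) by (f_equal; ring).
    apply is_lim_seq_mult'; [apply is_lim_seq_const|].
    apply is_lim_seq_minus'; [apply is_lim_seq_const | exact (Series_correct b (H2_sq_summable f))]. }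
  destruct (proj2 (is_lim_seq_spec _ _) L (mkposreal _ He)) as [N HN].
  exists N; intros m Hm; specialize (HN m Hm); simpl in HN.
  apply Rabs_def2 in HN; simpl; lra. }
destruct (H2_complete (lincomb (H2_coef f) s)) as [g Hg].
- intros eps He.
  destruct (L (eps ^ 2)) as [N HN]; [now apply pow_lt|]; exists N.
  assert (W : forall m n, (N <= m)%nat -> (m <= n)%nat ->
    H2_norm (minus (lincomb (H2_coef f) s n) (lincomb (H2_coef f) s m)) <= eps).
  { intros m n Hm Hmn; apply sq_le_reg; [lra|].
    replace n with (m + (n - m))%nat by lia.
    apply Rle_trans with (1 := Tail m (n - m)%nat), HN, Hm. }
  intros m n Hm Hn; destruct (Nat.le_ge_cases m n); [rewrite norm_minus_sym|]; now apply W.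
- exists g; split; [|exact Hg].
  apply le_epsilon; intros eps He; destruct (Hg eps He) as [N HN].
  apply Rle_trans with (1 := norm_le_minus g (lincomb (H2_coef f) s N)).
  apply Rplus_le_compat; [|now apply HN].
  apply sq_le_reg; [apply Rmult_le_pos; [exact HK | apply H2_norm_ge_0]|].
  apply Rle_trans with (1 := Hs _ _); rewrite Rpow_mult_distr.
  apply Rmult_le_compat_l; [apply pow2_ge_0|].
  rewrite H2_norm2; apply sum_n_le_Series; [exact Pb | apply H2_sq_summable].
Qed.

(** The value of the extension when the columns are [s n = w u ^ n]. *)
Lemma synthesis_val (s : nat -> H2) (f g : H2) (z w u : C) : disk z -> disk u ->
  (forall n, s n z = (w * u ^ n)%C) ->
  (forall eps, 0 < eps -> exists N, forall n, (N <= n)%nat ->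
      H2_norm (minus g (lincomb (H2_coef f) s n)) <= eps) ->
  g z = (w * f u)%C.
Proof.
intros Hz Hu Hs Hg.
assert (L1 : is_series (V := C_NormedModule) (fun n => H2_coef f n * s n z)%C (w * f u)%C).
{ rewrite (H2_val f u Hu).
  refine (is_series_ext _ _ _ _ (is_series_scal_l (V := C_NormedModule) w _ _
    (pval_correct _ u (H2_bounded f) Hu))).
  intros n; rewrite Hs; change ((w * (H2_coef f n * u ^ n))%C = (H2_coef f n * (w * u ^ n))%C); ring. }
refine (filterlim_locally_unique (V := C_NormedModule) (F := eventually)
  (sum_n (fun n => H2_coef f n * s n z)%C) _ _ _ L1).
apply (filterlim_locally_ball_norm (U := C_NormedModule)); intros eps.
set (k := sqrt (/ (1 - Cmod z ^ 2))).
assert (Hk : 0 <= k) by apply sqrt_pos.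
destruct (Hg (eps / (k + 1))) as [N HN];
  [apply Rdiv_lt_0_compat; [apply cond_pos | lra]|].
exists N; intros n Hn; specialize (HN n Hn).
rewrite <- lincomb_val.
change (Cmod (lincomb (H2_coef f) s n z - g z)%C < eps).
rewrite <- val_minus.
apply Rle_lt_trans with (1 := H2_val_le _ z Hz); fold k; rewrite norm_minus_sym.
apply Rle_lt_trans with (eps / (k + 1) * k); [now apply Rmult_le_compat_r|].
replace (eps / (k + 1) * k) with (eps * (k / (k + 1))) by (field; lra).
destruct eps as [e He]; simpl.
rewrite <- (Rmult_1_r e) at 2; apply Rmult_lt_compat_l; [exact He|].
apply Rlt_div_l; lra.
Qed.

(** * Multiplication operators *)

Lemma H2_ext_coef (f g : H2) : (forall n, H2_coef f n = H2_coef g n) -> f = g.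
Proof.
intros E; apply H2_eq; intros z Hz; rewrite !H2_val by exact Hz.
unfold pval, CSeries; f_equal; apply Series_ext; intros n; now rewrite E.
Qed.

Lemma shift_summable (a : nat -> C) : ex_series (fun k => Cmod (a k) ^ 2) ->
  ex_series (fun k => Cmod (match k with O => RtoC 0 | S j => a j end) ^ 2).
Proof. intros H; apply (ex_series_incr_1 (V := R_NormedModule)); exact H. Qed.

(** Multiplication by the coordinate [z]. *)
Definition shift (f : H2) : H2 := H2_of _ (shift_summable _ (H2_sq_summable f)).

Lemma shift_val (f : H2) z : disk z -> shift f z = (z * f z)%C.
Proof.
intros Hz; rewrite !H2_val by exact Hz.
rewrite pval_incr; [apply Cplus_0_l | apply H2_bounded | exact Hz].
Qed.

Lemma inner_shift (f g : H2) : H2_inner (shift f) (shift g) = H2_inner f g.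
Proof.
assert (E := inner_summable (shift f) (shift g)).
unfold H2_inner; f_equal; (rewrite Series_incr_1; [simpl; ring|]);
  refine (ex_series_le (V := R_CompleteNormedModule) _ _ _ E);
  intros n; [apply re_le_Cmod | apply im_le_Cmod].
Qed.

Lemma norm_shift (f : H2) : H2_norm (shift f) = H2_norm f.
Proof. unfold H2_norm; now rewrite inner_shift. Qed.

(** The coefficients of the quotient by [z + d] of the power series with
    coefficients [a]. *)
Fixpoint resolvent_coef (d : C) (a : nat -> C) (n : nat) : C :=
  match n with
  | O => a O / d
  | S k => (a n - resolvent_coef d a k) / d
  end%C.

Lemma resolvent_summable (d : C) (a : nat -> C) : 1 < Cmod d ->
  ex_series (fun k => Cmod (a k) ^ 2) ->
  ex_series (fun k => Cmod (resolvent_coef d a k) ^ 2).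
Proof.
intros Hd Ha.
set (h := resolvent_coef d a); set (G := Series (fun k => Cmod (a k) ^ 2)).
set (D := Cmod d ^ 2); assert (HD : 1 < D) by (unfold D; nra).
(* (x + y)^2 <= M x^2 + (1 + D) / 2 y^2 with (1 + D) / 2 < D *)
set (M := (D + 1) / (D - 1)).
assert (HM : 1 <= M) by (unfold M; apply Rle_div_r; lra).
assert (d <> RtoC 0) by (intros ->; rewrite Cmod_0 in Hd; lra).
assert (Y : forall x y, (x + y) ^ 2 <= M * x ^ 2 + (1 + D) / 2 * y ^ 2).
{ intros x y.
  assert (E : M * x ^ 2 + (1 + D) / 2 * y ^ 2 - (x + y) ^ 2
     = (2 * x - (D - 1) * y) ^ 2 / (2 * (D - 1))) by (unfold M; field; lra).
  assert (0 <= (2 * x - (D - 1) * y) ^ 2 / (2 * (D - 1)))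
    by (apply Rmult_le_pos; [apply pow2_ge_0 | apply Rlt_le, Rinv_0_lt_compat; lra]).
  lra. }
assert (HaN : forall n, sum_n (fun k => Cmod (a k) ^ 2) n <= G)
  by (intros n; apply sum_n_le_Series; [intros k; apply pow2_ge_0 | exact Ha]).
assert (St : forall n, D * sum_n (fun k => Cmod (h k) ^ 2) (S n) <=
   M * sum_n (fun k => Cmod (a k) ^ 2) (S n)
   + (1 + D) / 2 * sum_n (fun k => Cmod (h k) ^ 2) n).
{ assert (H0 : D * Cmod (h 0%nat) ^ 2 <= M * Cmod (a 0%nat) ^ 2).
  { replace (D * Cmod (h 0%nat) ^ 2) with (Cmod (a 0%nat) ^ 2).
    - pose proof (pow2_ge_0 (Cmod (a 0%nat))); nra.
    - unfold h, D; simpl resolvent_coef; rewrite Cmod_div by assumption; field; lra. }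
  assert (H1 : forall n, D * Cmod (h (S n)) ^ 2 <=
     M * Cmod (a (S n)) ^ 2 + (1 + D) / 2 * Cmod (h n) ^ 2).
  { intros n; unfold h at 1, D at 1; simpl resolvent_coef; fold h.
    rewrite Cmod_div by assumption.
    apply Rle_trans with (2 := Y _ _).
    replace (Cmod d ^ 2 * (Cmod (a (S n) - h n) / Cmod d) ^ 2)
      with (Cmod (a (S n) - h n)%C ^ 2) by (field; lra).
    apply pow_incr; split; [apply Cmod_ge_0|].
    apply Rle_trans with (1 := Cmod_triangle _ _); rewrite Cmod_opp; lra. }
  intros n; induction n as [|n IH].
  - rewrite !sum_Sn, !sum_O; specialize (H1 0%nat).
    change (plus ?x ?y) with (x + y); lra.
  - rewrite (sum_Sn _ (S n)), (sum_Sn (fun k => Cmod (a k) ^ 2) (S n)).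
    rewrite (sum_Sn (fun k => Cmod (h k) ^ 2) n) at 2.
    specialize (H1 (S n)); change (plus ?x ?y) with (x + y); lra. }
apply (fun X => proj1 (pos_series_bounded _ (2 * M * G / (D - 1)) (fun n => pow2_ge_0 _) X)).
intros n; apply Rle_div_r; [lra|].
specialize (St n); specialize (HaN (S n)).
assert (sum_n (fun k => Cmod (h k) ^ 2) n <= sum_n (fun k => Cmod (h k) ^ 2) (S n)).
{ rewrite sum_Sn; change (plus ?x ?y) with (x + y).
  pose proof (pow2_ge_0 (Cmod (h (S n)))); lra. }
nra.
Qed.

(** Multiplication by [1 / (z + d)], where [d] is outside the closed disk. *)
Definition resolvent (d : C) (Hd : 1 < Cmod d) (f : H2) : H2 :=
  H2_of _ (resolvent_summable d _ Hd (H2_sq_summable f)).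

Lemma disk_plus_neq_0 (d z : C) : 1 < Cmod d -> disk z -> (z + d)%C <> RtoC 0.
Proof.
unfold disk; intros Hd Hz E.
assert (d = (- z)%C) as E' by (replace d with ((z + d) - z)%C by ring; rewrite E; ring).
rewrite E', Cmod_opp in Hd; lra.
Qed.

Lemma outside_neq_0 (d : C) : 1 < Cmod d -> d <> RtoC 0.
Proof. intros Hd ->; rewrite Cmod_0 in Hd; lra. Qed.

Lemma resolvent_mult (d : C) (Hd : 1 < Cmod d) (f : H2) :
  plus (shift (resolvent d Hd f)) (scal d (resolvent d Hd f)) = f.
Proof.
pose proof (outside_neq_0 d Hd) as N.
apply H2_ext_coef; intros [|n]; simpl; field; exact N.
Qed.

Lemma resolvent_val (d : C) (Hd : 1 < Cmod d) (f : H2) z : disk z ->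
  resolvent d Hd f z = (f z / (z + d))%C.
Proof.
intros Hz; pose proof (disk_plus_neq_0 d z Hd Hz) as N.
rewrite <- (resolvent_mult d Hd f) at 2.
rewrite val_plus, val_scal, shift_val by exact Hz; field; exact N.
Qed.

Lemma shift_plus (f g : H2) : shift (plus f g) = plus (shift f) (shift g).
Proof. apply H2_ext_coef; intros [|n]; simpl; ring. Qed.

Lemma shift_scal (c : C) (f : H2) : shift (scal c f) = scal c (shift f).
Proof. apply H2_ext_coef; intros [|n]; simpl; ring. Qed.

(** The constant function [1]. *)
Definition H2_one : H2 := kernel (RtoC 0) disk_0.

Lemma H2_one_val z : disk z -> H2_one z = RtoC 1.
Proof.
intros Hz; unfold H2_one; rewrite kernel_val by exact Hz.
replace (1 - Cconj 0 * z)%C with (RtoC 1) by (rewrite Cconj_RtoC; ring).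
field; apply C1_nz.
Qed.

(** * Averages of an isometry with the identity *)

(** Strict convexity of the square of the norm. *)
Lemma norm2_convex (t : R) (x y : H2) :
  H2_norm (plus (scal (RtoC (1 - t)) x) (scal (RtoC t) y)) ^ 2
  = (1 - t) * H2_norm x ^ 2 + t * H2_norm y ^ 2 - t * (1 - t) * H2_norm (minus x y) ^ 2.
Proof.
replace (minus x y) with (plus x (scal (RtoC (-1)) y)).
2: { apply H2_ext_coef; intros n; rewrite coef_minus.
     simpl; ring_simplify.
     unfold RtoC; apply injective_projections; simpl; ring. }
rewrite !norm2_plus, !norm2_scal, inner_scal_l, !inner_scal_r, !Cmod_R.
rewrite !pow2_abs.
destruct (H2_inner x y) as [a b]; simpl; ring.
Qed.

(** The convex combination [(1 - t) g + t V g]. *)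
Definition average (t : R) (V : H2 -> H2) (g : H2) : H2 :=
  plus (scal (RtoC (1 - t)) g) (scal (RtoC t) (V g)).

Lemma average_norm2 t V g : (forall g, H2_norm (V g) = H2_norm g) ->
  H2_norm (average t V g) ^ 2 = H2_norm g ^ 2 - t * (1 - t) * H2_norm (minus g (V g)) ^ 2.
Proof. intros HV; unfold average; rewrite norm2_convex, HV; ring. Qed.

(** Horner's rule. *)
Lemma lincomb_shift (a : nat -> C) (L : H2 -> H2) (u : H2) n :
  (forall f g, L (plus f g) = plus (L f) (L g)) ->
  (forall c f, L (scal c f) = scal c (L f)) ->
  lincomb a (fun k => Nat.iter k L u) (S n) =
  plus (scal (a 0%nat) u) (L (lincomb (fun k => a (S k)) (fun k => Nat.iter k L u) n)).
Proof.
intros Hp Hs; induction n as [|n IH].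
- rewrite lincomb_S, !lincomb_0, Hs; reflexivity.
- rewrite lincomb_S, IH, lincomb_S, Hp, Hs.
  symmetry; apply (plus_assoc (G := H2_AbelianMonoid)).
Qed.

(** If [V] is isometric and [u] is orthogonal to its range, the vectors
    [((1 - t) + t V)^n u] form a Bessel system.  By Horner's rule a combination
    of them is [a 0 u + (1 - t) x + t V x], with [x] a shorter combination. *)
Lemma average_bessel (t : R) (V : H2 -> H2) (u : H2) : 0 < t <= 1 ->
  (forall f g, V (plus f g) = plus (V f) (V g)) ->
  (forall c f, V (scal c f) = scal c (V f)) ->
  (forall g, H2_norm (V g) = H2_norm g) ->
  (forall g, H2_inner (V g) u = RtoC 0) ->
  forall a n, H2_norm (lincomb a (fun k => Nat.iter k (average t V) u) n) ^ 2
    <= H2_norm u ^ 2 / t * sum_n (fun k => Cmod (a k) ^ 2) n.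
Proof.
intros Ht Hp Hs HV Hu a n; revert a; induction n as [|n IH]; intros a.
- rewrite lincomb_0, sum_O; simpl Nat.iter; rewrite norm2_scal.
  replace (H2_norm u ^ 2 / t * Cmod (a 0%nat) ^ 2)
    with (Cmod (a 0%nat) ^ 2 * H2_norm u ^ 2 * / t) by (field; lra).
  rewrite <- (Rmult_1_r (_ * _)) at 1.
  apply Rmult_le_compat_l; [apply Rmult_le_pos; apply pow2_ge_0|].
  rewrite <- Rinv_1; apply Rinv_le_contravar; lra.
- rewrite lincomb_shift.
  2: { intros f g; unfold average; rewrite Hp; apply H2_ext_coef; intros k; simpl; ring. }
  2: { intros c f; unfold average; rewrite Hs; apply H2_ext_coef; intros k; simpl; ring. }
  specialize (IH (fun k => a (S k))).
  set (x := lincomb _ _ n) in *.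
  assert (Ntz : RtoC t <> RtoC 0) by (intros E; apply RtoC_inj in E; lra).
  (* [a 0 u] is absorbed into the second vector of the convex combination *)
  replace (plus (scal (a 0%nat) u) (average t V x)) with
    (plus (scal (RtoC (1 - t)) x) (scal (RtoC t) (plus (V x) (scal (a 0%nat / RtoC t)%C u)))).
  2: { apply H2_ext_coef; intros k; unfold average; simpl; field; exact Ntz. }
  rewrite norm2_convex, norm2_plus, norm2_scal, inner_scal_r, Hu, HV.
  rewrite Cmult_0_r; change (Re (RtoC 0)) with 0.
  rewrite Cmod_div, Cmod_R, Rabs_pos_eq by (assumption || lra).
  assert (Es : sum_n (fun k => Cmod (a k) ^ 2) (S n) =
     Cmod (a 0%nat) ^ 2 + sum_n (fun k => Cmod (a (S k)) ^ 2) n).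
  { clear; induction n as [|n IH]; [rewrite sum_Sn, !sum_O; reflexivity|].
    rewrite sum_Sn, IH, sum_Sn; apply Rplus_assoc. }
  rewrite Es.
  set (A := Cmod (a 0%nat)) in *.
  set (z := minus x _).
  assert (0 <= t * (1 - t) * H2_norm z ^ 2)
    by (apply Rmult_le_pos; [apply Rmult_le_pos; lra | apply pow2_ge_0]).
  assert (E : t * ((A / t) ^ 2 * H2_norm u ^ 2) = H2_norm u ^ 2 / t * A ^ 2) by (field; lra).
  lra.
Qed.

(** * Hilbert-Schmidt operators are compact *)

(** The function [z^n]. *)
Definition monomial (n : nat) : H2 := Nat.iter n shift H2_one.

Lemma monomial_val n z : disk z -> monomial n z = (z ^ n)%C.
Proof.
intros Hz; induction n as [|n IH]; [now apply H2_one_val|].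
change (shift (monomial n) z = (z * z ^ n)%C).
rewrite shift_val by exact Hz; now rewrite IH.
Qed.

Lemma H2_one_norm2 : H2_norm H2_one ^ 2 = 1.
Proof. unfold H2_one; rewrite kernel_norm2, Cmod_0; field. Qed.

Lemma inner_shift_one f : H2_inner (shift f) H2_one = RtoC 0.
Proof. unfold H2_one; rewrite reproducing, shift_val by exact disk_0; ring. Qed.

(** The case [t = 1], [V = shift], [u = 1] of the Bessel inequality. *)
Lemma monomial_bessel a n :
  H2_norm (lincomb a monomial n) ^ 2 <= 1 ^ 2 * sum_n (fun k => Cmod (a k) ^ 2) n.
Proof.
replace (lincomb a monomial n) with (lincomb a (fun k => Nat.iter k (average 1 shift) H2_one) n).
- apply Rle_trans with (H2_norm H2_one ^ 2 / 1 * sum_n (fun k => Cmod (a k) ^ 2) n).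
  + apply average_bessel; [lra | exact shift_plus | exact shift_scal | exact norm_shift
      | exact inner_shift_one].
  + rewrite H2_one_norm2; apply Req_le; field.
- apply H2_eq; intros z Hz; rewrite !lincomb_val; apply sum_n_ext; intros k; f_equal.
  rewrite monomial_val by exact Hz; induction k as [|k IH]; [now apply H2_one_val|].
  rewrite Nat.iter_succ; unfold average at 1; rewrite val_plus, !val_scal, shift_val, IH by exact Hz.
  replace (1 - 1) with 0 by ring; simpl; ring.
Qed.

(** The Taylor series of [f] converges to [f] in norm. *)
Lemma taylor_norm (f : H2) eps : 0 < eps -> exists N, forall n, (N <= n)%nat ->
  H2_norm (minus f (lincomb (H2_coef f) monomial n)) <= eps.
Proof.
revert eps; destruct (synthesis monomial 1 Rle_0_1 monomial_bessel f) as [g [_ Hg]].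
assert (E : g = f); [|rewrite E in Hg; exact Hg].
apply H2_eq; intros z Hz; rewrite (synthesis_val monomial f g z (RtoC 1) z); try assumption.
- ring.
- intros n; rewrite monomial_val by exact Hz; ring.
Qed.

Lemma lincomb_linear (L : H2 -> H2) a s n : is_linear L ->
  L (lincomb a s n) = lincomb a (fun k => L (s k)) n.
Proof.
intros HL; induction n as [|n IH].
- rewrite !lincomb_0; apply (linear_scal _ HL).
- rewrite !lincomb_S, <- IH, <- (linear_scal _ HL); apply (linear_plus _ HL).
Qed.

Lemma norm_lincomb_le a s n :
  H2_norm (lincomb a s n) <= sum_n (fun k => Cmod (a k) * H2_norm (s k)) n.
Proof.
induction n as [|n IH].
- rewrite lincomb_0, sum_O, H2_norm_scal; lra.
- rewrite lincomb_S, sum_Sn; apply Rle_trans with (1 := H2_norm_triangle _ _).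
  rewrite H2_norm_scal; apply Rplus_le_compat_r, IH.
Qed.

Lemma ex_series_mult_sq (a b : nat -> R) :
  ex_series (fun k => a k ^ 2) -> ex_series (fun k => b k ^ 2) ->
  (forall k, 0 <= a k) -> (forall k, 0 <= b k) -> ex_series (fun k => a k * b k).
Proof.
intros Ha Hb Pa Pb.
apply (ex_series_le (V := R_CompleteNormedModule) _ (fun k => a k ^ 2 + b k ^ 2)).
- intros k; unfold norm; simpl; unfold abs; simpl.
  rewrite Rabs_pos_eq by now apply Rmult_le_pos.
  specialize (Pa k); specialize (Pb k); nra.
- now apply (ex_series_plus (V := R_NormedModule)).
Qed.

Lemma norm_linear_le (L : H2 -> H2) (f : H2) : is_linear L ->
  ex_series (fun n => H2_norm (L (monomial n)) ^ 2) ->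
  H2_norm (L f) <= Series (fun k => Cmod (H2_coef f k) * H2_norm (L (monomial k))).
Proof.
intros HL Hs; destruct (linear_norm _ HL) as [M [HM B]].
change (forall x, H2_norm (L x) <= M * H2_norm x) in B.
apply le_epsilon; intros e He.
destruct (taylor_norm f (e / M)) as [N HN]; [now apply Rdiv_lt_0_compat|].
set (p := lincomb (H2_coef f) monomial N).
replace f with (plus p (minus f p)) at 1.
2: { apply H2_eq; intros z _; rewrite val_plus, val_minus; ring. }
rewrite (linear_plus _ HL).
apply Rle_trans with (1 := H2_norm_triangle _ _), Rplus_le_compat.
- unfold p; rewrite lincomb_linear by exact HL.
  apply Rle_trans with (1 := norm_lincomb_le _ _ _), sum_n_le_Series.
  + intros k; apply Rmult_le_pos; [apply Cmod_ge_0 | apply H2_norm_ge_0].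
  + apply ex_series_mult_sq; [apply H2_sq_summable | exact Hs
      | intros; apply Cmod_ge_0 | intros; apply H2_norm_ge_0].
- apply Rle_trans with (1 := B _).
  apply Rle_trans with (M * (e / M)); [apply Rmult_le_compat_l; [lra | now apply HN]|].
  apply Req_le; field; lra.
Qed.

(** Cantor's diagonal extraction. *)
Lemma diagonal (X : nat -> nat -> R) (M : R) : (forall j k, Rabs (X j k) <= M) ->
  exists (s : nat -> nat) (c : nat -> R), (forall n, (s n < s (S n))%nat) /\
    forall k, is_lim_seq (fun j => X (s j) k) (c k).
Proof.
intros HM.
(* [Cl m c]: the first [m] entries of [c] form a cluster point *)
set (Cl := fun m (c : nat -> R) => forall eps, 0 < eps -> forall N, exists j, (N <= j)%nat /\
  forall k, (k < m)%nat -> Rabs (X j k - c k) < eps).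
assert (Step : forall m c, Cl m c -> exists l,
  Cl (S m) (fun k => if lt_dec k m then c k else l)).
{ intros m c Hc.
  destruct (function_choice (fun i j => (i <= j)%nat /\
     forall k, (k < m)%nat -> Rabs (X j k - c k) < / (INR i + 1))) as [J HJ].
  { intros i; apply Hc, Rinv_0_lt_compat; pose proof (pos_INR i); lra. }
  destruct (Bolzano_Weierstrass (fun i => X (J i) m) _ (compact_P3 (- M) M)) as [l Hl].
  { intros i; apply Rabs_le_between, HM. }
  exists l; intros eps He N.
  destruct (archimed_cor1 eps He) as [n0 [Hn0 Pn0]].
  destruct (Hl (disc l (mkposreal eps He)) (max N n0)) as [p [Hp D]].
  { exists (mkposreal eps He); intros y Hy; exact Hy. }
  destruct (HJ p) as [HJ1 HJ2].
  exists (J p); split; [lia|]; intros k Hk; destruct (lt_dec k m) as [L|L].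
  - apply Rlt_trans with (1 := HJ2 k L), Rle_lt_trans with (2 := Hn0).
    apply Rinv_le_contravar; [now apply lt_0_INR|].
    apply Rle_trans with (INR p); [apply le_INR; lia | lra].
  - replace k with m by lia; exact D. }
set (C0 := exist (Cl 0%nat) (fun _ => 0) (fun eps He N => ex_intro _ N
  (conj (le_n N) (fun k (Hk : (k < 0)%nat) => False_ind _ (Nat.nlt_0_r k Hk))))).
set (Cs := nat_rect (fun m => {c | Cl m c}) C0 (fun m c =>
  let (l, Hl) := constructive_indefinite_description _ (Step m _ (proj2_sig c)) in
  exist _ _ Hl)).
assert (HS : forall m k, (k < m)%nat -> proj1_sig (Cs (S m)) k = proj1_sig (Cs m) k).
{ intros m k Hk; simpl.
  destruct (constructive_indefinite_description _ _) as [l Hl]; simpl.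
  destruct (lt_dec k m); [reflexivity | lia]. }
set (c := fun k => proj1_sig (Cs (S k)) k).
assert (Hc : forall m, Cl m c).
{ intros m eps He N; destruct (proj2_sig (Cs m) eps He N) as [j [Hj B]].
  exists j; split; [exact Hj|]; intros k Hk; replace (c k) with (proj1_sig (Cs m) k); [now apply B|].
  unfold c; clear - HS Hk; induction m as [|m IH]; [lia|].
  destruct (Nat.eq_dec k m) as [->|]; [reflexivity|].
  rewrite HS by lia; apply IH; lia. }
destruct (function_choice (fun (np : nat * nat) j => (S (snd np) <= j)%nat /\
  forall k, (k < fst np)%nat -> Rabs (X j k - c k) < / (INR (fst np) + 1))) as [Nx HNx].
{ intros [n p]; apply Hc, Rinv_0_lt_compat; pose proof (pos_INR n); simpl; lra. }
set (s := nat_rect (fun _ => nat) (Nx (0, 0)%nat) (fun n p => Nx (S n, p))).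
assert (Hs : forall n k, (k < n)%nat -> Rabs (X (s n) k - c k) < / (INR n + 1)).
{ intros [|n]; [lia|]; exact (proj2 (HNx (S n, s n))). }
exists s, c; split; [intros n; exact (proj1 (HNx (S n, s n)))|].
intros k; apply is_lim_seq_spec; intros eps.
destruct (archimed_cor1 eps (cond_pos eps)) as [n0 [Hn0 Pn0]].
exists (max (S k) n0); intros n Hn.
apply Rlt_trans with (1 := Hs n k ltac:(lia)), Rle_lt_trans with (2 := Hn0).
apply Rinv_le_contravar; [now apply lt_0_INR|].
apply Rle_trans with (INR n); [apply le_INR; lia | lra].
Qed.

Lemma is_lim_seq_Cmod_0 (u : nat -> C) (x y : R) :
  is_lim_seq (fun j => Re (u j)) x -> is_lim_seq (fun j => Im (u j)) y ->
  is_lim_seq (fun j => Cmod (u j - (x, y))%C) 0.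
Proof.
intros H1 H2.
assert (L : is_lim_seq (fun j => Rabs (Re (u j) - x) + Rabs (Im (u j) - y)) 0).
{ replace (Finite 0) with (Finite (Rabs (x - x) + Rabs (y - y)))
    by (rewrite !Rminus_diag, Rabs_R0; f_equal; ring).
  apply is_lim_seq_plus'; apply (is_lim_seq_abs _ (Finite (_ - _)));
    apply is_lim_seq_minus'; try assumption; apply is_lim_seq_const. }
refine (is_lim_seq_le_le _ _ _ _ _ (is_lim_seq_const 0) L); intros j; split; [apply Cmod_ge_0|].
replace (u j - (x, y))%C with (RtoC (Re (u j) - x) + Ci * RtoC (Im (u j) - y))%C.
- apply Rle_trans with (1 := Cmod_triangle _ _); rewrite Cmod_mult, Cmod_Ci, !Cmod_R; lra.
- destruct (u j); apply injective_projections; simpl; ring.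
Qed.

(** A bounded sequence has a subsequence that converges coefficientwise, and the
    Hilbert-Schmidt condition turns this into norm convergence of the images. *)
Lemma hilbert_schmidt_compact (L : H2 -> H2) : is_linear L ->
  ex_series (fun n => H2_norm (L (monomial n)) ^ 2) -> compact_operator L.
Proof.
intros HL Hs; split; [exact HL|].
intros x [M HM]; change (forall n, H2_norm (x n) <= M) in HM.
assert (PM : 0 <= M) by (apply Rle_trans with (2 := HM 0%nat), H2_norm_ge_0).
destruct (diagonal (fun j k => if Nat.even k then Re (H2_coef (x j) (Nat.div2 k))
   else Im (H2_coef (x j) (Nat.div2 k))) M) as [s [c [Hmono Hc]]].
{ intros j k; apply Rle_trans with (Cmod (H2_coef (x j) (Nat.div2 k))).
  - destruct (Nat.even k); [apply re_le_Cmod | apply im_le_Cmod].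
  - apply Rle_trans with (1 := H2_coef_le _ _), HM. }
set (a := fun k => (c (2 * k)%nat, c (S (2 * k))) : C).
assert (Ha : forall k, is_lim_seq (fun j => Cmod (H2_coef (x (s j)) k - a k)%C) 0).
{ intros k; apply is_lim_seq_Cmod_0.
  - apply is_lim_seq_ext with (2 := Hc (2 * k)%nat); intros j.
    rewrite Nat.even_mul, Nat.div2_double; reflexivity.
  - apply is_lim_seq_ext with (2 := Hc (S (2 * k))); intros j.
    rewrite Nat.even_succ, Nat.odd_mul, Nat.div2_succ_double; reflexivity. }
destruct (coef_limit_bound (fun j => x (s j)) a M Ha) as [Sa Ba].
{ exists 0%nat; intros j _; apply HM. }
set (y := H2_of a Sa).
exists s, (L y); split; [exact Hmono|].
assert (By : H2_norm y <= M).
{ apply sq_le_reg; [exact PM|]; rewrite H2_norm2; exact Ba. }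
set (g := fun j => minus (x (s j)) y).
assert (Bg : forall j, H2_norm (g j) <= 2 * M).
{ intros j; unfold g; rewrite norm_minus_sym.
  pose proof (H2_norm_triangle y (scal (- RtoC 1)%C (x (s j)))) as T.
  rewrite H2_norm_scal, Cmod_m1 in T; specialize (HM (s j)).
  change (minus y (x (s j))) with (plus y (scal (- RtoC 1)%C (x (s j)))); lra. }
set (b := fun k => H2_norm (L (monomial k))); fold b in Hs.
change (ex_series (fun n => b n ^ 2)) in Hs.
assert (Pb : forall k, 0 <= b k) by (intros k; apply H2_norm_ge_0).
assert (Lim : forall eps, 0 < eps -> exists N, forall j, (N <= j)%nat -> H2_norm (L (g j)) < eps).
{ intros eps He.
  (* [|g_k| b_k <= th |g_k|^2 + b_k^2 / (4 th)] with [th] chosen so that the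
     first term contributes at most [eps / 4]  *)
  set (th := eps / (4 * (4 * M ^ 2 + 1))).
  assert (Hth : 0 < th) by (apply Rdiv_lt_0_compat; [exact He | pose proof (pow2_ge_0 M); lra]).
  assert (LT : is_lim_seq (fun K => / (4 * th) * (Series (fun n => b n ^ 2) - sum_n (fun n => b n ^ 2) K)) 0).
  { replace (Finite 0) with (Finite (/ (4 * th) * (Series (fun n => b n ^ 2) - Series (fun n => b n ^ 2))))
      by (f_equal; ring).
    apply is_lim_seq_mult'; [apply is_lim_seq_const|].
    apply is_lim_seq_minus'; [apply is_lim_seq_const | exact (Series_correct _ Hs)]. }
  assert (He4 : 0 < eps / 4) by lra.
  destruct (proj2 (is_lim_seq_spec _ _) LT (mkposreal _ He4)) as [K HK].
  specialize (HK K (le_n K)); cbn [pos] in HK; apply Rabs_def2 in HK.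
  assert (LK : is_lim_seq (fun j => sum_n (fun k => Cmod (H2_coef (g j) k) * b k) K) 0).
  { replace 0 with (sum_n (fun k => 0 * b k) K).
    - apply is_lim_seq_sum_n; intros k; apply is_lim_seq_mult'; [|apply is_lim_seq_const].
      apply is_lim_seq_ext with (2 := Ha k); intros j; unfold g; now rewrite coef_minus.
    - clear; induction K as [|K IH]; [rewrite sum_O; apply Rmult_0_l|].
      rewrite sum_Sn, IH, Rmult_0_l; apply Rplus_0_l. }
  destruct (proj2 (is_lim_seq_spec _ _) LK (mkposreal _ He4)) as [N HN].
  exists N; intros j Hj; specialize (HN j Hj); cbn [pos] in HN; apply Rabs_def2 in HN.
  apply Rle_lt_trans with (1 := norm_linear_le L (g j) HL Hs); fold b.
  change (Series (fun k => Cmod (H2_coef (g j) k) * b k) < eps).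
  pose proof (H2_sq_summable (g j)) as Sg.
  assert (Ex : ex_series (fun k => Cmod (H2_coef (g j) k) * b k))
    by (apply ex_series_mult_sq; [exact Sg | exact Hs | intros; apply Cmod_ge_0 | exact Pb]).
  rewrite (Series_incr_n _ (S K) (Nat.lt_0_succ K) Ex); cbn [Init.Nat.pred].
  rewrite (Series_incr_n _ (S K) (Nat.lt_0_succ K) Hs), <- sum_n_Reals in HK; cbn [Init.Nat.pred] in HK.
  rewrite <- sum_n_Reals.
  assert (Tl : Series (fun k => Cmod (H2_coef (g j) (S K + k)) * b (S K + k)%nat) <=
    th * H2_norm (g j) ^ 2 + / (4 * th) * Series (fun k => b (S K + k)%nat ^ 2)).
  { assert (Sg' := proj1 (ex_series_incr_n (V := R_NormedModule) _ (S K)) Sg).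
    assert (Hs' := proj1 (ex_series_incr_n (V := R_NormedModule) _ (S K)) Hs).
    apply Rle_trans with (th * Series (fun k => Cmod (H2_coef (g j) (S K + k)) ^ 2)
       + / (4 * th) * Series (fun k => b (S K + k)%nat ^ 2)).
    - rewrite <- !Series_scal_l, <- Series_plus;
        try (apply (ex_series_scal_l (V := R_NormedModule)); assumption).
      apply Series_le.
      + intros k; set (u := Cmod _); set (v := b _); split;
          [apply Rmult_le_pos; [apply Cmod_ge_0 | apply Pb]|].
        assert (E : th * u ^ 2 + / (4 * th) * v ^ 2 - u * v = th * (u - v / (2 * th)) ^ 2)
          by (field; lra).
        assert (0 <= th * (u - v / (2 * th)) ^ 2) by (apply Rmult_le_pos; [lra | apply pow2_ge_0]).
        lra.
      + apply (ex_series_plus (V := R_NormedModule));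
          apply (ex_series_scal_l (V := R_NormedModule)); assumption.
    - apply Rplus_le_compat_r, Rmult_le_compat_l; [lra|].
      rewrite H2_norm2, (Series_incr_n _ (S K) (Nat.lt_0_succ K) Sg), <- sum_n_Reals.
      assert (0 <= sum_n (fun k => Cmod (H2_coef (g j) k) ^ 2) K).
      { clear; induction K as [|K IH]; [rewrite sum_O; apply pow2_ge_0|].
        rewrite sum_Sn; apply Rplus_le_le_0_compat; [exact IH | apply pow2_ge_0]. }
      cbn [Init.Nat.pred]; lra. }
  assert (th * H2_norm (g j) ^ 2 <= eps / 4).
  { apply Rle_trans with (th * (4 * M ^ 2)).
    - apply Rmult_le_compat_l; [lra|]; replace (4 * M ^ 2) with ((2 * M) ^ 2) by ring.
      apply pow_incr; split; [apply H2_norm_ge_0 | apply Bg].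
    - unfold th; replace (eps / (4 * (4 * M ^ 2 + 1)) * (4 * M ^ 2))
        with (eps / 4 * ((4 * M ^ 2) / (4 * M ^ 2 + 1))) by (field; pose proof (pow2_ge_0 M); lra).
      rewrite <- (Rmult_1_r (eps / 4)) at 2; apply Rmult_le_compat_l; [lra|].
      pose proof (pow2_ge_0 M); apply Rle_div_l; lra. }
  lra. }
apply (filterlim_locally (U := H2_UniformSpace)); intros eps.
destruct (Lim eps (cond_pos eps)) as [N HN]; exists N; intros j Hj.
change (H2_norm (minus (L (x (s j))) (L y)) < eps).
replace (minus (L (x (s j))) (L y)) with (L (g j)); [now apply HN|].
unfold g, minus; rewrite (linear_plus _ HL); f_equal.
change (L (scal (- RtoC 1)%C y) = scal (- RtoC 1)%C (L y)); apply (linear_scal _ HL).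
Qed.

(** * The symbol *)

(** The unimodular constant that makes [tau d] fix [1]. *)
Definition eta (d : C) : C := ((1 + d) / (1 + Cconj d))%C.

(** The automorphism of the disk with pole [- d] that fixes [1]. *)
Definition tau (d z : C) : C := (eta d * (1 + Cconj d * z) / (z + d))%C.

(** The radius of the disk onto which [linfrac q d] maps the unit disk. *)
Definition radius (q : R) (d : C) : R := q * Cmod (1 + d)%C ^ 2 / (Cmod d ^ 2 - 1).

Lemma one_plus_neq_0 (d : C) : 1 < Cmod d -> (1 + d)%C <> RtoC 0.
Proof.
intros Hd E; assert (d = - (1))%C as -> by (replace d with ((1 + d) - 1)%C by ring; rewrite E; ring).
rewrite Cmod_m1 in Hd; lra.
Qed.

Lemma one_plus_conj_neq_0 (d : C) : 1 < Cmod d -> (1 + Cconj d)%C <> RtoC 0.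
Proof. intros Hd; apply one_plus_neq_0; now rewrite Cmod_conj. Qed.

Lemma Cmod_one_plus_conj (d : C) : Cmod (1 + Cconj d)%C = Cmod (1 + d)%C.
Proof.
rewrite <- (Cmod_conj (1 + d)), Cplus_conj; f_equal; f_equal.
symmetry; apply Cconj_RtoC.
Qed.

Lemma Cmod_one_plus_pos (d : C) : 1 < Cmod d -> 0 < Cmod (1 + d)%C.
Proof. intros Hd; apply Cmod_gt_0, one_plus_neq_0, Hd. Qed.

Lemma Cmod_sq_gt_1 (d : C) : 1 < Cmod d -> 0 < Cmod d ^ 2 - 1.
Proof. intros H; nra. Qed.

Lemma Cmod_eta (d : C) : 1 < Cmod d -> Cmod (eta d) = 1.
Proof.
intros Hd; unfold eta; rewrite Cmod_div by now apply one_plus_conj_neq_0.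
rewrite Cmod_one_plus_conj; pose proof (Cmod_one_plus_pos d Hd); field; lra.
Qed.

Lemma radius_pos q d : 0 < q -> 1 < Cmod d -> 0 < radius q d.
Proof.
intros Hq Hd; unfold radius; apply Rdiv_lt_0_compat; [|now apply Cmod_sq_gt_1].
apply Rmult_lt_0_compat; [exact Hq | now apply pow_lt, Cmod_one_plus_pos].
Qed.

Lemma radius_C q d : 1 < Cmod d ->
  RtoC (radius q d) = (q * ((1 + d) * (1 + Cconj d)) / (d * Cconj d - 1))%C.
Proof.
intros Hd; pose proof (Cmod_sq_gt_1 d Hd) as H.
unfold radius; rewrite RtoC_div, RtoC_mult, RtoC_minus by lra.
rewrite !Cmod2_conj, Cplus_conj, Cconj_RtoC.
reflexivity.
Qed.

Lemma norm_conj_neq_1 d : 1 < Cmod d -> (d * Cconj d - 1)%C <> RtoC 0.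
Proof.
intros Hd; rewrite <- Cmod2_conj, <- RtoC_minus; intros E.
apply RtoC_inj in E; pose proof (Cmod_sq_gt_1 d Hd); lra.
Qed.

Lemma linfrac_tau q d z : 1 < Cmod d -> disk z ->
  linfrac q d z = (RtoC (1 - radius q d) + RtoC (radius q d) * tau d z)%C.
Proof.
intros Hd Hz; rewrite RtoC_minus, radius_C by exact Hd; unfold linfrac, tau, eta.
pose proof (disk_plus_neq_0 d z Hd Hz); pose proof (norm_conj_neq_1 d Hd).
pose proof (one_plus_conj_neq_0 d Hd).
field; auto.
Qed.

(** The inverse of [tau d]. *)
Definition tau_inv (d w : C) : C := ((w * d - eta d) / (eta d * Cconj d - w))%C.

Lemma tau_inv_den d w : 1 < Cmod d -> disk w -> (eta d * Cconj d - w)%C <> RtoC 0.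
Proof.
intros Hd Hw E.
assert (Cmod w = Cmod d).
{ replace w with (eta d * Cconj d - (eta d * Cconj d - w))%C by ring.
  rewrite E; replace (eta d * Cconj d - 0)%C with (eta d * Cconj d)%C by ring.
  rewrite Cmod_mult, Cmod_eta, Cmod_conj by exact Hd; ring. }
unfold disk in Hw; lra.
Qed.

Lemma tau_inv_defect (d w e : C) : Cmod e = 1 ->
  Cmod (e * Cconj d - w)%C ^ 2 - Cmod (w * d - e)%C ^ 2 = (Cmod d ^ 2 - 1) * (1 - Cmod w ^ 2).
Proof.
intros He; assert (He2 : Cmod e ^ 2 = 1) by (rewrite He; ring).
transitivity ((Cmod d ^ 2 - 1) * (Cmod e ^ 2 - Cmod w ^ 2)); [|now rewrite He2].
rewrite !Cmod2_alt; destruct d, w, e; simpl; ring.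
Qed.

Lemma tau_inv_disk d w : 1 < Cmod d -> disk w -> disk (tau_inv d w).
Proof.
intros Hd Hw; pose proof (tau_inv_den d w Hd Hw) as N.
assert (P : 0 < Cmod (eta d * Cconj d - w)%C) by now apply Cmod_gt_0.
unfold disk, tau_inv; rewrite Cmod_div by assumption.
apply Rlt_div_l; [exact P|]; rewrite Rmult_1_l.
pose proof (tau_inv_defect d w (eta d) (Cmod_eta d Hd)) as E.
unfold disk in Hw; pose proof (Cmod_ge_0 w).
assert (0 < (Cmod d ^ 2 - 1) * (1 - Cmod w ^ 2)) by (apply Rmult_lt_0_compat; nra).
pose proof (Cmod_ge_0 (w * d - eta d)%C); nra.
Qed.

Lemma eta_neq_0 d : 1 < Cmod d -> eta d <> RtoC 0.
Proof. intros Hd; apply Cmod_gt_0; rewrite Cmod_eta by exact Hd; lra. Qed.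

Lemma tau_tau_inv d w : 1 < Cmod d -> disk w -> tau d (tau_inv d w) = w.
Proof.
intros Hd Hw.
pose proof (disk_plus_neq_0 d _ Hd (tau_inv_disk d w Hd Hw)) as N.
pose proof (tau_inv_den d w Hd Hw) as N'.
pose proof (norm_conj_neq_1 d Hd) as N1; pose proof (eta_neq_0 d Hd) as N2.
unfold tau, tau_inv in *; set (e := eta d) in *.
field; split; [exact N'|].
replace (w * d - e + d * (e * Cconj d - w))%C with (e * (d * Cconj d - 1))%C by ring.
now apply Cmult_neq_0.
Qed.

Lemma tau_inj d z w : 1 < Cmod d -> disk z -> disk w -> tau d z = tau d w -> z = w.
Proof.
intros Hd Hz Hw E.
pose proof (disk_plus_neq_0 d z Hd Hz) as Nz; pose proof (disk_plus_neq_0 d w Hd Hw) as Nw.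
pose proof (norm_conj_neq_1 d Hd) as N1; pose proof (eta_neq_0 d Hd) as N2.
assert (E' : (eta d * (d * Cconj d - 1) * (z - w) / ((z + d) * (w + d)) = 0)%C).
{ transitivity (tau d z - tau d w)%C; [unfold tau; field; auto | rewrite E; ring]. }
assert (z - w = 0)%C.
{ transitivity (eta d * (d * Cconj d - 1) * (z - w) / ((z + d) * (w + d))
    * ((z + d) * (w + d)) / (eta d * (d * Cconj d - 1)))%C; [field; auto | rewrite E'; field; auto]. }
replace z with (z - w + w)%C by ring; rewrite H; ring.
Qed.

(** * Multiplication by [tau d] *)

(** The operator of multiplication by [tau d]. *)
Definition tau_mul (d : C) (Hd : 1 < Cmod d) (g : H2) : H2 :=
  scal (eta d) (plus (resolvent d Hd g) (scal (Cconj d) (shift (resolvent d Hd g)))).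

Lemma tau_mul_val d Hd g z : disk z -> tau_mul d Hd g z = (tau d z * g z)%C.
Proof.
intros Hz; pose proof (disk_plus_neq_0 d z Hd Hz) as N.
unfold tau_mul, tau; rewrite val_scal, val_plus, val_scal, shift_val, resolvent_val by exact Hz.
field; exact N.
Qed.

(** [tau d] has modulus one on the circle: [|1 + conj d z| = |z + d|] there. *)
Lemma tau_mul_norm d Hd g : H2_norm (tau_mul d Hd g) = H2_norm g.
Proof.
assert (E : H2_norm (tau_mul d Hd g) ^ 2 = H2_norm g ^ 2).
{ unfold tau_mul; rewrite <- (resolvent_mult d Hd g) at 3.
  set (h := resolvent d Hd g).
  rewrite norm2_scal, Cmod_eta, !norm2_plus, !norm2_scal, norm_shift by exact Hd.
  rewrite !inner_scal_r, (inner_conj (shift h) h), Cmod_conj.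
  destruct (H2_inner (shift h) h), d; simpl; ring. }
apply Rle_antisym; apply sq_le_reg; try apply H2_norm_ge_0; lra.
Qed.

Lemma tau_mul_plus d Hd f g : tau_mul d Hd (plus f g) = plus (tau_mul d Hd f) (tau_mul d Hd g).
Proof.
apply H2_eq; intros z Hz; rewrite val_plus, !tau_mul_val, val_plus by exact Hz; ring.
Qed.

Lemma tau_mul_scal d Hd c f : tau_mul d Hd (scal c f) = scal c (tau_mul d Hd f).
Proof.
apply H2_eq; intros z Hz; rewrite val_scal, !tau_mul_val, val_scal by exact Hz; ring.
Qed.

(** The function [1 / (z + d)]. *)
Definition pole (d : C) (Hd : 1 < Cmod d) : H2 := resolvent d Hd H2_one.

Lemma tau_zero_disk d : 1 < Cmod d -> disk (- / Cconj d)%C.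
Proof.
intros Hd; unfold disk; rewrite Cmod_opp, Cmod_inv, Cmod_conj.
- rewrite <- Rinv_1; apply Rinv_lt_contravar; lra.
- apply outside_neq_0; now rewrite Cmod_conj.
Qed.

Lemma Cconj_tau_zero d : 1 < Cmod d -> Cconj (- / Cconj d)%C = (- / d)%C.
Proof.
intros Hd; rewrite Copp_conj, Cinv_conj, Cconj_conj; [reflexivity|].
apply outside_neq_0; now rewrite Cmod_conj.
Qed.

(** [1 / (z + d)] is a multiple of the reproducing kernel at the zero
    [- 1 / conj d] of [tau d]. *)
Lemma pole_kernel d Hd : pole d Hd = scal (/ d)%C (kernel _ (tau_zero_disk d Hd)).
Proof.
pose proof (outside_neq_0 d Hd) as N.
apply H2_eq; intros z Hz; pose proof (disk_plus_neq_0 d z Hd Hz) as Nz.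
unfold pole; rewrite val_scal, resolvent_val, H2_one_val, kernel_val, Cconj_tau_zero by assumption.
field; repeat split; try assumption.
replace (d - -1 * z)%C with (z + d)%C by ring; exact Nz.
Qed.

Lemma pole_norm2 d Hd : H2_norm (pole d Hd) ^ 2 = / (Cmod d ^ 2 - 1).
Proof.
pose proof (outside_neq_0 d Hd) as N; pose proof (Cmod_sq_gt_1 d Hd).
rewrite pole_kernel, norm2_scal, kernel_norm2, Cmod_opp, !Cmod_inv, Cmod_conj
  by (try (apply outside_neq_0; rewrite ?Cmod_conj); assumption).
replace (1 - (/ Cmod d) ^ 2) with ((Cmod d ^ 2 - 1) / Cmod d ^ 2) by (field; lra).
field; lra.
Qed.

Lemma inner_tau_pole d Hd g : H2_inner (tau_mul d Hd g) (pole d Hd) = RtoC 0.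
Proof.
pose proof (outside_neq_0 d Hd) as N.
assert (N' : Cconj d <> RtoC 0) by (apply outside_neq_0; now rewrite Cmod_conj).
rewrite pole_kernel, inner_scal_r, reproducing, tau_mul_val by now apply tau_zero_disk.
unfold tau; replace (1 + Cconj d * (- / Cconj d))%C with (RtoC 0) by (field; exact N').
unfold Cdiv; ring.
Qed.

(** * The image of the disk *)

(** If the radius is [1], then [linfrac q d] is [tau d]; if it is larger than
    [1], the image is not contained in the disk. *)
Lemma radius_lt_1 (q : R) (d : C) : 0 < q -> 1 < Cmod d ->
  disk_self_map (linfrac q d) -> ~ disk_automorphism (linfrac q d) -> radius q d < 1.
Proof.
intros Hq Hd hself hnaut.
pose proof (radius_pos q d Hq Hd) as Pr.
destruct (Rtotal_order (radius q d) 1) as [H|[H|H]]; [exact H| |]; exfalso.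
- apply hnaut.
  assert (E : forall z, disk z -> linfrac q d z = tau d z).
  { intros z Hz; rewrite linfrac_tau, H, Rminus_diag by assumption; ring. }
  split; [|split; [exact hself | split]].
  + intros z Hz; destruct (H2_holo (tau_mul d Hd H2_one) z Hz) as [l Hl]; exists l.
    apply (is_derive_ext_loc (V := C_NormedModule)) with (2 := Hl).
    assert (Pz : 0 < 1 - Cmod z) by (unfold disk in Hz; lra).
    exists (mkposreal _ Pz); intros y Hy; change (Cmod (y - z)%C < 1 - Cmod z) in Hy.
    assert (Dy : disk y).
    { unfold disk; replace y with (z + (y - z))%C by ring.
      pose proof (Cmod_triangle z (y - z)); lra. }
    rewrite tau_mul_val, H2_one_val, E by exact Dy; apply Cmult_1_r.
  + intros z w Hz Hw; rewrite !E by assumption; now apply tau_inj.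
  + intros w Hw; exists (tau_inv d w); split; [now apply tau_inv_disk|].
    rewrite E by (now apply tau_inv_disk); now apply tau_tau_inv.
- (* the point that tau sends to [- 1 / radius] is sent to [- radius] *)
  set (r := radius q d) in *.
  assert (Hir : / r < 1) by (rewrite <- Rinv_1; apply Rinv_lt_contravar; lra).
  assert (Pir : 0 < / r) by now apply Rinv_0_lt_compat.
  set (w := RtoC (- / r)).
  assert (Hw : disk w) by (unfold w, disk; rewrite Cmod_R, Rabs_left; lra).
  pose proof (hself _ (tau_inv_disk d w Hd Hw)) as D.
  rewrite linfrac_tau, tau_tau_inv in D by (try apply tau_inv_disk; assumption).
  fold r in D; unfold w in D; rewrite <- RtoC_mult, <- RtoC_plus in D; unfold disk in D.
  replace (1 - r + r * - / r) with (- r) in D by (field; lra).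
  rewrite Cmod_R, Rabs_left in D; lra.
Qed.

(** * Operator norms *)

Lemma op_norm_le (L : H2 -> H2) (M : R) : 0 <= M ->
  (forall x, H2_norm (L x) <= M * H2_norm x) ->
  exists r, op_norm L = Finite r /\ 0 <= r <= M.
Proof.
intros HM HL.
destruct (Lub_Rbar_correct (fun r => exists x : H2, norm x <= 1 /\ r = norm (L x))) as [U B].
fold (op_norm L) in U, B.
assert (B' : Rbar_le (op_norm L) (Finite M)).
{ apply B; intros r [x [Hx ->]]; simpl.
  apply Rle_trans with (1 := HL x); change (H2_norm x <= 1) in Hx; nra. }
assert (U' : Rbar_le (Finite (H2_norm (L H2_zero))) (op_norm L)).
{ apply U; exists H2_zero; split; [|reflexivity].
  change (norm (zero : H2_NormedModule) <= 1); rewrite norm_zero; lra. }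
pose proof (H2_norm_ge_0 (L H2_zero)).
destruct (op_norm L) as [r| |]; simpl in U', B'; try contradiction.
exists r; split; [reflexivity | lra].
Qed.

Lemma op_norm_bound (L : H2 -> H2) (r : R) :
  (forall c x, L (scal c x) = scal c (L x)) -> Rbar_le (op_norm L) (Finite r) ->
  forall x, H2_norm (L x) <= r * H2_norm x.
Proof.
intros HL Hr x.
destruct (Lub_Rbar_correct (fun r => exists x : H2, norm x <= 1 /\ r = norm (L x))) as [U _].
fold (op_norm L) in U.
pose proof (H2_norm_ge_0 x) as P.
destruct (Req_dec (H2_norm x) 0) as [Z|N].
- apply H2_norm_eq_0 in Z.
  assert (E : x = scal (RtoC 0) x)
    by (rewrite Z; symmetry; apply (scal_zero_r (V := H2_ModuleSpace))).
  rewrite E, HL, !H2_norm_scal, Cmod_0; lra.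
- set (y := scal (RtoC (/ H2_norm x)) x).
  assert (Hy : H2_norm y <= 1).
  { unfold y; rewrite H2_norm_scal, Cmod_R, Rabs_pos_eq
      by (apply Rlt_le, Rinv_0_lt_compat; lra).
    apply Req_le; field; exact N. }
  assert (By : H2_norm (L y) <= r).
  { apply (Rbar_le_trans (Finite _) (op_norm L) (Finite r)); [|exact Hr].
    apply U; exists y; split; [exact Hy | reflexivity]. }
  unfold y in By; rewrite HL, H2_norm_scal, Cmod_R, Rabs_pos_eq in By
    by (apply Rlt_le, Rinv_0_lt_compat; lra).
  apply Rmult_le_reg_l with (/ H2_norm x); [apply Rinv_0_lt_compat; lra|].
  replace (/ H2_norm x * (r * H2_norm x)) with r by (field; exact N); exact By.
Qed.

Lemma ess_norm_le (L K : H2 -> H2) (M : R) : 0 <= M -> compact_operator K ->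
  (forall x, H2_norm (plus (L x) (K x)) <= M * H2_norm x) ->
  Rbar_le (ess_norm L) (Finite M).
Proof.
intros HM HK HL.
destruct (op_norm_le (fun x => plus (L x) (K x)) M HM HL) as [r [Er Hr]].
destruct (Glb_Rbar_correct (fun r => exists S : H2 -> H2, compact_operator S /\
    Finite r = op_norm (fun x => plus (L x) (S x)))) as [G _].
apply Rbar_le_trans with (Finite r); [|simpl; lra].
apply G; exists K; split; [exact HK | symmetry; exact Er].
Qed.

Lemma compact_zero : compact_operator (fun _ : H2 => H2_zero).
Proof.
split.
- split.
  + intros x y; symmetry; apply (plus_zero_l (G := H2_AbelianMonoid)).
  + intros c x; symmetry; apply (scal_zero_r (V := H2_ModuleSpace)).
  + exists 1; split; [lra|]; intros x.
    change (norm (zero : H2_NormedModule) <= 1 * H2_norm x); rewrite norm_zero.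
    pose proof (H2_norm_ge_0 x); lra.
- intros x _; exists (fun n => n), H2_zero; split; [intros n; lia|].
  apply (filterlim_const (U := H2_UniformSpace)).
Qed.

(** * The composition operator *)

Lemma lincomb_scal (c : C) a s n : lincomb a (fun k => scal c (s k)) n = scal c (lincomb a s n).
Proof.
induction n as [|n IH].
- rewrite !lincomb_0; apply H2_ext_coef; intros k; simpl; ring.
- rewrite !lincomb_S, IH; apply H2_ext_coef; intros k; simpl; ring.
Qed.

Lemma iter_average_val q d Hd (u : H2) n z : disk z ->
  Nat.iter n (average (radius q d) (tau_mul d Hd)) u z = (u z * linfrac q d z ^ n)%C.
Proof.
intros Hz; induction n as [|n IH]; [simpl; ring|].
rewrite Nat.iter_succ; unfold average at 1.
rewrite val_plus, !val_scal, tau_mul_val, IH, linfrac_tau by assumption; simpl; ring.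
Qed.

(** The operator [f |-> (1 + d) / (z + d) * (f o phi)] is bounded by
    [1 / sqrt q].  It maps [z^n] to [(1 + d) ((1 - r) + r tau)^n / (z + d)]. *)
Lemma weighted_exists (q : R) (d : C) (f : H2) : 0 < q -> 1 < Cmod d ->
  radius q d <= 1 -> disk_self_map (linfrac q d) ->
  exists g : H2, H2_norm g <= sqrt (/ q) * H2_norm f /\
    forall z, disk z -> g z = ((1 + d) / (z + d) * f (linfrac q d z))%C.
Proof.
intros Hq Hd Hr hself.
pose proof (radius_pos q d Hq Hd) as Pr.
set (s := fun n => scal (1 + d)%C
  (Nat.iter n (average (radius q d) (tau_mul d Hd)) (pole d Hd))).
destruct (synthesis s (sqrt (/ q)) (sqrt_pos _)) with (f := f) as [g [Bg Hg]].
- intros a n; unfold s; rewrite lincomb_scal, norm2_scal.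
  rewrite pow2_sqrt by (apply Rlt_le, Rinv_0_lt_compat, Hq).
  apply Rle_trans with (Cmod (1 + d)%C ^ 2 *
    (H2_norm (pole d Hd) ^ 2 / radius q d * sum_n (fun k => Cmod (a k) ^ 2) n)).
  + apply Rmult_le_compat_l; [apply pow2_ge_0|].
    apply average_bessel; [lra | apply tau_mul_plus | apply tau_mul_scal
      | apply tau_mul_norm | apply inner_tau_pole].
  + apply Req_le; rewrite pole_norm2; unfold radius.
    pose proof (Cmod_sq_gt_1 d Hd); pose proof (Cmod_one_plus_pos d Hd).
    field; lra.
- exists g; split; [exact Bg|]; intros z Hz.
  apply (synthesis_val s f g z ((1 + d) / (z + d))%C (linfrac q d z) Hz (hself z Hz)); [|exact Hg].
  intros n; unfold s; rewrite val_scal, iter_average_val by exact Hz.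
  unfold pole; rewrite resolvent_val, H2_one_val by exact Hz.
  field; now apply disk_plus_neq_0.
Qed.

(** The composite [f o phi] belongs to the Hardy space, being [(z + d) / (1 + d)]
    times the function of the preceding lemma. *)
Lemma comp_op_val (q : R) (d : C) (f : H2) z : 0 < q -> 1 < Cmod d ->
  radius q d <= 1 -> disk_self_map (linfrac q d) -> disk z ->
  comp_op (linfrac q d) f z = f (linfrac q d z).
Proof.
intros Hq Hd Hr hself Hz.
apply (epsilon_spec (inhabits H2_zero)
  (fun g : H2 => forall z : C, disk z -> g z = f (linfrac q d z))); [|exact Hz].
destruct (weighted_exists q d f Hq Hd Hr hself) as [g [_ Hg]].
exists (scal (/ (1 + d))%C (plus (shift g) (scal d g))).
clear z Hz; intros z Hz.
rewrite val_scal, val_plus, val_scal, shift_val, Hg by exact Hz.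
field; split; [now apply disk_plus_neq_0 | now apply one_plus_neq_0].
Qed.

(** [f |-> (1 + d) / (z + d) * (f o phi)], for [phi] the map [linfrac q d]. *)
Definition weighted (q : R) (d : C) (Hd : 1 < Cmod d) (f : H2) : H2 :=
  scal (1 + d)%C (resolvent d Hd (comp_op (linfrac q d) f)).

Lemma weighted_val (q : R) (d : C) Hd (f : H2) z : 0 < q ->
  radius q d <= 1 -> disk_self_map (linfrac q d) -> disk z ->
  weighted q d Hd f z = ((1 + d) / (z + d) * f (linfrac q d z))%C.
Proof.
intros Hq Hr hself Hz; unfold weighted.
rewrite val_scal, resolvent_val, comp_op_val by assumption.
field; now apply disk_plus_neq_0.
Qed.

Lemma weighted_norm (q : R) (d : C) Hd (f : H2) : 0 < q ->
  radius q d <= 1 -> disk_self_map (linfrac q d) ->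
  H2_norm (weighted q d Hd f) <= sqrt (/ q) * H2_norm f.
Proof.
intros Hq Hr hself.
destruct (weighted_exists q d f Hq Hd Hr hself) as [g [Bg Hg]].
replace (weighted q d Hd f) with g; [exact Bg|].
apply H2_eq; intros z Hz; rewrite weighted_val by assumption; now apply Hg.
Qed.

Lemma comp_op_weighted (q : R) (d : C) Hd (f : H2) : 0 < q ->
  radius q d <= 1 -> disk_self_map (linfrac q d) ->
  comp_op (linfrac q d) f = scal (/ (1 + d))%C
    (plus (shift (weighted q d Hd f)) (scal d (weighted q d Hd f))).
Proof.
intros Hq Hr hself; apply H2_eq; intros z Hz.
rewrite val_scal, val_plus, val_scal, shift_val, weighted_val, comp_op_val by assumption.
field; split; [now apply disk_plus_neq_0 | now apply one_plus_neq_0].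
Qed.

Lemma comp_op_norm_le (q : R) (d : C) (f : H2) : 0 < q -> 1 < Cmod d ->
  radius q d <= 1 -> disk_self_map (linfrac q d) ->
  H2_norm (comp_op (linfrac q d) f) <= (1 + Cmod d) / Cmod (1 + d)%C * (sqrt (/ q) * H2_norm f).
Proof.
intros Hq Hd Hr hself; pose proof (Cmod_one_plus_pos d Hd) as P.
rewrite (comp_op_weighted q d Hd f) by assumption.
rewrite H2_norm_scal, Cmod_inv by now apply one_plus_neq_0.
apply Rle_trans with (/ Cmod (1 + d)%C * ((1 + Cmod d) * H2_norm (weighted q d Hd f))).
- apply Rmult_le_compat_l; [now apply Rlt_le, Rinv_0_lt_compat|].
  apply Rle_trans with (1 := H2_norm_triangle _ _).
  rewrite H2_norm_scal, norm_shift; lra.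
- unfold Rdiv; rewrite (Rmult_comm _ (/ _)), Rmult_assoc.
  apply Rmult_le_compat_l; [now apply Rlt_le, Rinv_0_lt_compat|].
  apply Rmult_le_compat_l; [lra|]; now apply weighted_norm.
Qed.

Lemma comp_op_scal (q : R) (d c : C) (f : H2) : 0 < q -> 1 < Cmod d ->
  radius q d <= 1 -> disk_self_map (linfrac q d) ->
  comp_op (linfrac q d) (scal c f) = scal c (comp_op (linfrac q d) f).
Proof.
intros; apply H2_eq; intros z Hz; rewrite val_scal, !comp_op_val by assumption.
now rewrite val_scal.
Qed.

(** The difference of the two operators is Hilbert-Schmidt: it sends [z^n] to a
    multiple of [(1 - tau) phi^n], with a factor independent of [n]. *)
Lemma weighted_minus_comp_compact (q : R) (d : C) Hd : 0 < q ->
  radius q d < 1 -> disk_self_map (linfrac q d) ->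
  compact_operator (fun f => minus (weighted q d Hd f) (comp_op (linfrac q d) f)).
Proof.
intros Hq Hr hself; set (r := radius q d) in *.
assert (Hr' : radius q d <= 1) by (fold r; lra).
assert (Pr : 0 < r) by now apply radius_pos.
assert (P1 : 0 < Cmod (1 + d)%C) by now apply Cmod_one_plus_pos.
apply hilbert_schmidt_compact.
- split.
  + intros f g; apply H2_eq; intros z Hz.
    rewrite val_plus, !val_minus, !weighted_val, !comp_op_val, val_plus by assumption; ring.
  + intros c f; apply H2_eq; intros z Hz.
    rewrite val_scal, !val_minus, !weighted_val, !comp_op_val, val_scal by assumption; ring.
  + set (k := (1 + Cmod d) / Cmod (1 + d)%C * sqrt (/ q)).
    assert (Pk : 0 < sqrt (/ q)) by now apply sqrt_lt_R0, Rinv_0_lt_compat.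
    assert (Pk' : 0 < k) by (apply Rmult_lt_0_compat; [apply Rdiv_lt_0_compat|]; lra).
    exists (sqrt (/ q) + k); split; [lra|]; intros f.
    change (H2_norm (plus (weighted q d Hd f) (scal (- RtoC 1)%C (comp_op (linfrac q d) f)))
      <= (sqrt (/ q) + k) * H2_norm f).
    apply Rle_trans with (1 := H2_norm_triangle _ _); rewrite H2_norm_scal, Cmod_m1.
    pose proof (weighted_norm q d Hd f Hq Hr' hself).
    pose proof (comp_op_norm_le q d f Hq Hd Hr' hself); unfold k; lra.
- set (t := fun n => Nat.iter n (average r (tau_mul d Hd)) H2_one).
  set (e := fun n => H2_norm (minus (t n) (tau_mul d Hd (t n))) ^ 2).
  apply ex_series_ext with (fun n => (r / (q * Cmod (1 + d)%C)) ^ 2 * e n).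
  + intros n; unfold e; rewrite <- Rpow_mult_distr; f_equal.
    replace (r / (q * Cmod (1 + d)%C)) with (Cmod (RtoC r / (RtoC q * (1 + d)))%C).
    2: { rewrite Cmod_div, Cmod_mult, !Cmod_R, !Rabs_pos_eq; try lra.
         apply Cmult_neq_0; [intros E; apply RtoC_inj in E; lra | now apply one_plus_neq_0]. }
    rewrite <- H2_norm_scal; f_equal; apply H2_eq; intros z Hz.
    rewrite val_scal, !val_minus, weighted_val, comp_op_val, tau_mul_val by assumption.
    unfold t, r; rewrite iter_average_val, H2_one_val, monomial_val by (try apply hself; assumption).
    set (p := (linfrac q d z ^ n)%C).
    pose proof (disk_plus_neq_0 d z Hd Hz); pose proof (one_plus_neq_0 d Hd).
    pose proof (norm_conj_neq_1 d Hd); pose proof (one_plus_conj_neq_0 d Hd).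
    assert (RtoC q <> RtoC 0) by (intros E; apply RtoC_inj in E; lra).
    rewrite radius_C by exact Hd; unfold tau, eta; field; repeat split; assumption.
  + apply (ex_series_scal_l (V := R_NormedModule)).
    apply (fun X => proj1 (pos_series_bounded e (/ (r * (1 - r))) (fun n => pow2_ge_0 _) X)).
    assert (Pd : 0 < r * (1 - r)) by (apply Rmult_lt_0_compat; lra).
    (* the sum telescopes *)
    assert (St : forall n, e n = / (r * (1 - r)) * (H2_norm (t n) ^ 2 - H2_norm (t (S n)) ^ 2)).
    { intros n; unfold e; change (t (S n)) with (average r (tau_mul d Hd) (t n)).
      rewrite average_norm2 by apply tau_mul_norm; field; lra. }
    assert (Sm : forall n, sum_n e n = / (r * (1 - r)) * (1 - H2_norm (t (S n)) ^ 2)).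
    { induction n as [|n IH].
      - rewrite sum_O, St; change (t 0%nat) with H2_one; now rewrite H2_one_norm2.
      - rewrite sum_Sn, IH, St; change (plus ?x ?y) with (x + y); lra. }
    intros n; rewrite Sm; rewrite <- (Rmult_1_r (/ _)) at 2.
    apply Rmult_le_compat_l; [now apply Rlt_le, Rinv_0_lt_compat|].
    pose proof (pow2_ge_0 (H2_norm (t (S n)))); lra.
Qed.

Lemma ess_norm_comp_le (q : R) (d : C) : 0 < q -> 1 < Cmod d ->
  radius q d < 1 -> disk_self_map (linfrac q d) ->
  Rbar_le (ess_norm (comp_op (linfrac q d))) (Finite (sqrt (/ q))).
Proof.
intros Hq Hd Hr hself.
apply ess_norm_le with (1 := sqrt_pos _)
  (2 := weighted_minus_comp_compact q d Hd Hq Hr hself).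
intros f; replace (plus _ _) with (weighted q d Hd f).
- apply weighted_norm; try assumption; lra.
- apply H2_eq; intros z _; rewrite val_plus, val_minus; ring.
Qed.

(** * Lower bound for the essential norm *)

(** The inverse of the norm of the reproducing kernel at [a]. *)
Definition height (a : C) : R := sqrt (1 - Cmod a ^ 2).

Lemma height_sq a : disk a -> height a ^ 2 = 1 - Cmod a ^ 2.
Proof.
intros Ha; unfold height; apply pow2_sqrt.
unfold disk in Ha; pose proof (Cmod_ge_0 a); nra.
Qed.

Lemma height_pos a : disk a -> 0 < height a <= 1.
Proof.
intros Ha; unfold disk in Ha; pose proof (Cmod_ge_0 a).
split; unfold height.
- apply sqrt_lt_R0; nra.
- apply Rle_trans with (sqrt 1); [apply sqrt_le_1_alt; nra | rewrite sqrt_1; lra].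
Qed.

(** The normalized reproducing kernel. *)
Definition unit_kernel (a : C) (Ha : disk a) : H2 := scal (RtoC (height a)) (kernel a Ha).

Lemma unit_kernel_norm2 a Ha : H2_norm (unit_kernel a Ha) ^ 2 = 1.
Proof.
unfold unit_kernel; rewrite norm2_scal, kernel_norm2, Cmod_R, pow2_abs, height_sq by exact Ha.
unfold disk in Ha; pose proof (Cmod_ge_0 a); field; nra.
Qed.

Lemma inner_unit_kernel f a Ha : H2_inner f (unit_kernel a Ha) = (RtoC (height a) * f a)%C.
Proof.
unfold unit_kernel; rewrite inner_scal_r, reproducing; f_equal.
apply Cconj_RtoC.
Qed.

Lemma unit_kernel_self a Ha : (RtoC (height a) * unit_kernel a Ha a)%C = RtoC 1.
Proof. now rewrite <- (inner_unit_kernel _ a Ha), inner_self, unit_kernel_norm2. Qed.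

Lemma kernel_le a b Ha : disk b ->
  Cmod (kernel a Ha b) <= / (1 - Cmod a) /\ Cmod (kernel a Ha b) <= / (1 - Cmod b).
Proof.
intros Hb; pose proof (one_minus_neq_0 _ (Cmod_mult_lt_1 a b Ha Hb)) as N.
rewrite kernel_val, Cmod_inv by assumption.
pose proof (Cmod_triangle (1 - Cconj a * b) (Cconj a * b)) as T.
replace (1 - Cconj a * b + Cconj a * b)%C with (RtoC 1) in T by ring.
rewrite Cmod_1, Cmod_mult, Cmod_conj in T.
unfold disk in *; pose proof (Cmod_ge_0 a); pose proof (Cmod_ge_0 b).
split; apply Rinv_le_contravar; nra.
Qed.

Lemma unit_kernel_le a b Ha : disk b ->
  Cmod (unit_kernel a Ha b) <= height a / (1 - Cmod b) /\
  Cmod (unit_kernel a Ha b) <= / (1 - Cmod a).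
Proof.
intros Hb; destruct (kernel_le a b Ha Hb) as [K1 K2]; pose proof (height_pos a Ha).
unfold unit_kernel; rewrite val_scal, Cmod_mult, Cmod_R, Rabs_pos_eq by lra.
split; [apply Rmult_le_compat_l; [lra | exact K2]|].
apply Rle_trans with (2 := K1); pose proof (Cmod_ge_0 (kernel a Ha b)); nra.
Qed.

Lemma norm_unit_diff a b Ha Hb :
  H2_norm (minus (unit_kernel a Ha) (unit_kernel b Hb)) <= sqrt 2 * (1 + height b / (1 - Cmod a)).
Proof.
pose proof (height_pos b Hb) as P.
assert (Q : 0 < / (1 - Cmod a)) by (apply Rinv_0_lt_compat; unfold disk in Ha; lra).
set (u := height b / (1 - Cmod a)).
assert (Hu : 0 <= u) by (apply Rmult_le_pos; lra).
apply sq_le_reg; [apply Rmult_le_pos; [apply sqrt_pos | lra]|].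
rewrite Rpow_mult_distr, pow2_sqrt by lra.
change (minus (unit_kernel a Ha) (unit_kernel b Hb)) with
  (plus (unit_kernel a Ha) (scal (- RtoC 1)%C (unit_kernel b Hb))).
rewrite norm2_plus, norm2_scal, Cmod_m1, inner_scal_r, !unit_kernel_norm2, inner_unit_kernel.
replace (Cconj (- (1)) * (RtoC (height b) * unit_kernel a Ha b))%C
  with (- (RtoC (height b) * unit_kernel a Ha b))%C
  by (rewrite Copp_conj, Cconj_RtoC; ring).
rewrite re_opp.
assert (B : - Re (RtoC (height b) * unit_kernel a Ha b)%C <= u).
{ apply Rle_trans with (Cmod (RtoC (height b) * unit_kernel a Ha b)%C).
  - apply Rle_trans with (2 := re_le_Cmod _); rewrite <- Rabs_Ropp; apply Rle_abs.
  - rewrite Cmod_mult, Cmod_R, Rabs_pos_eq by lra.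
    apply Rmult_le_compat_l; [lra|]; now apply unit_kernel_le. }
nra.
Qed.

(** The hypothesis on [L] says that its adjoint sends the kernel at [p n] to the
    kernel at [s n].  Let [f n] and [g n] be the normalized kernels at [s n] and
    [p n].  Along a subsequence [K (f n)] converges, so that a compact [K] nearly
    annihilates [f j - f k].  But [f j] and [f k] become orthogonal as [k] tends
    to infinity, as do [g j] and [g k], and [L (f j - f k)] has an inner product
    of nearly [2 l] with [g j - g k]. *)
Lemma ess_norm_ge (L : H2 -> H2) (p s : nat -> C) (l : R)
  (Hp : forall n, disk (p n)) (Hs : forall n, disk (s n)) :
  (forall c x, L (scal c x) = scal c (L x)) ->
  (forall f n, L f (p n) = f (s n)) ->
  is_lim_seq (fun n => height (p n)) 0 -> is_lim_seq (fun n => height (s n)) 0 ->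
  is_lim_seq (fun n => height (p n) / height (s n)) l ->
  Rbar_le (Finite l) (ess_norm L).
Proof.
intros HL Hps Lp Ls Ll.
apply (Glb_Rbar_correct (fun r => exists S : H2 -> H2, compact_operator S /\
    Finite r = op_norm (fun x => plus (L x) (S x)))).
intros r [K [[HK HC] Er]].
assert (B : forall x, H2_norm (plus (L x) (K x)) <= r * H2_norm x).
{ apply op_norm_bound; [|exact (eq_ind (Finite r) (fun z => Rbar_le z (Finite r)) (Rle_refl r) _ Er)].
  intros c x; rewrite HL.
  rewrite (linear_scal _ HK); symmetry; apply (scal_distr_l (V := H2_ModuleSpace)). }
assert (Pr : 0 <= r).
{ pose proof (B (unit_kernel _ (Hp 0%nat))); pose proof (H2_norm_ge_0 (plus
    (L (unit_kernel _ (Hp 0%nat))) (K (unit_kernel _ (Hp 0%nat))))).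
  pose proof (unit_kernel_norm2 _ (Hp 0%nat)); pose proof (H2_norm_ge_0 (unit_kernel _ (Hp 0%nat))).
  nra. }
set (f := fun n => unit_kernel (s n) (Hs n)); set (g := fun n => unit_kernel (p n) (Hp n)).
destruct (HC f) as [m [y [Hm Hy]]].
{ exists 1; intros n; change (H2_norm (f n) <= 1); apply sq_le_reg; [lra|].
  unfold f; rewrite unit_kernel_norm2; lra. }
assert (Mm : forall N, eventually (fun n => (N <= m n)%nat)).
{ intros N; exists N; intros n Hn; apply Nat.le_trans with (1 := Hn).
  clear - Hm; induction n as [|n IH]; [lia|]; specialize (Hm n); lia. }
assert (Sub : forall u (l : Rbar), is_lim_seq u l -> is_lim_seq (fun n => u (m n)) l).
{ intros u l' Hu; apply (filterlim_comp _ _ _ m u eventually eventually); [|exact Hu].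
  intros P [N HN]; destruct (Mm N) as [N' HN']; exists N'; intros n Hn; apply HN, HN', Hn. }
set (e := fun n => H2_norm (minus (K (f (m n))) y)).
assert (Le : is_lim_seq e 0).
{ apply is_lim_seq_spec; intros eps.
  destruct (proj1 (filterlim_locally (U := H2_UniformSpace) _ _) Hy eps) as [N HN].
  exists N; intros n Hn; rewrite Rminus_0_r, Rabs_pos_eq by apply H2_norm_ge_0; exact (HN n Hn). }
set (h := fun n => height (p n)); set (t := fun n => height (s n)).
set (cs := fun n => / (1 - Cmod (s n))); set (cp := fun n => / (1 - Cmod (p n))).
(* the inequality given by the test vector [f j - f k] *)
assert (Main : forall j k,
  h j / t j + h k / t k - h j * (t k * cs j) - h k * cs j <=
  (r * (sqrt 2 * (1 + t k * cs j)) + H2_norm (minus (K (f j)) (K (f k))))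
   * (sqrt 2 * (1 + h k * cp j))).
{ intros j k; set (x := minus (f j) (f k)); set (v := minus (g j) (g k)).
  pose proof (height_pos _ (Hp j)) as Phj; pose proof (height_pos _ (Hp k)) as Phk.
  pose proof (height_pos _ (Hs j)) as Ptj; pose proof (height_pos _ (Hs k)) as Ptk.
  fold (h j) in Phj; fold (h k) in Phk; fold (t j) in Ptj; fold (t k) in Ptk.
  apply Rle_trans with (Re (H2_inner (L x) v)).
  - assert (Ev : H2_inner (L x) v = (RtoC (h j) * (f j (s j) - f k (s j))
        - RtoC (h k) * (f j (s k) - f k (s k)))%C).
    { unfold v; change (minus (g j) (g k)) with (plus (g j) (scal (- RtoC 1)%C (g k))).
      rewrite inner_plus_r, inner_scal_r; unfold g; rewrite !inner_unit_kernel, !Hps.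
      unfold x; rewrite !val_minus; fold (h j) (h k).
      rewrite Copp_conj, Cconj_RtoC.
      ring. }
    assert (Fs : forall n, f n (s n) = RtoC (/ t n)).
    { intros n; pose proof (height_pos _ (Hs n)) as Pn; pose proof (unit_kernel_self _ (Hs n)) as E.
      fold (f n) in E; fold (t n) in E, Pn.
      assert (RtoC (t n) <> RtoC 0) by (intros E'; apply RtoC_inj in E'; lra).
      rewrite RtoC_inv by lra.
      transitivity (RtoC (t n) * f n (s n) / RtoC (t n))%C; [field; assumption | rewrite E; field; assumption]. }
    assert (B1 : Re (f k (s j)) <= t k * cs j).
    { apply Rle_trans with (1 := Rle_abs _), Rle_trans with (1 := re_le_Cmod _).
      apply (unit_kernel_le (s k) (s j) (Hs k) (Hs j)). }
    assert (B2 : Re (f j (s k)) <= cs j).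
    { apply Rle_trans with (1 := Rle_abs _), Rle_trans with (1 := re_le_Cmod _).
      apply (unit_kernel_le (s j) (s k) (Hs j) (Hs k)). }
    rewrite Ev, !Fs.
    assert (ER : Re (RtoC (h j) * (RtoC (/ t j) - f k (s j)) - RtoC (h k) * (f j (s k) - RtoC (/ t k)))%C
      = h j / t j + h k / t k - h j * Re (f k (s j)) - h k * Re (f j (s k))).
    { destruct (f k (s j)), (f j (s k)); simpl; unfold Rdiv; ring. }
    rewrite ER.
    assert (h j * Re (f k (s j)) <= h j * (t k * cs j)) by (apply Rmult_le_compat_l; lra).
    assert (h k * Re (f j (s k)) <= h k * cs j) by (apply Rmult_le_compat_l; lra).
    lra.
  - apply Rle_trans with (1 := Re_inner_le _ _).
    apply Rmult_le_compat; try apply H2_norm_ge_0; [|apply norm_unit_diff].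
    replace (L x) with (minus (plus (L x) (K x)) (K x))
      by (apply H2_eq; intros z _; rewrite val_minus, val_plus; ring).
    change (minus (plus (L x) (K x)) (K x)) with
      (plus (plus (L x) (K x)) (scal (- RtoC 1)%C (K x))).
    apply Rle_trans with (1 := H2_norm_triangle _ _); rewrite H2_norm_scal, Cmod_m1, Rmult_1_l.
    apply Rplus_le_compat.
    + apply Rle_trans with (1 := B x), Rmult_le_compat_l; [exact Pr | apply norm_unit_diff].
    + apply Req_le; f_equal; unfold x, minus; rewrite (linear_plus _ HK); f_equal.
      change (K (scal (- RtoC 1)%C (f k)) = scal (- RtoC 1)%C (K (f k))); apply (linear_scal _ HK). }
assert (Tri : forall j k, H2_norm (minus (K (f (m j))) (K (f (m k)))) <= e j + e k).
{ intros j k; unfold e; rewrite (norm_minus_sym (K (f (m k)))).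
  replace (minus (K (f (m j))) (K (f (m k)))) with
    (plus (minus (K (f (m j))) y) (minus y (K (f (m k))))); [apply H2_norm_triangle|].
  apply H2_eq; intros z _; rewrite val_plus, !val_minus; ring. }
assert (S2 : 0 <= sqrt 2) by apply sqrt_pos.
assert (S22 : sqrt 2 * sqrt 2 = 2) by (apply sqrt_sqrt; lra).
assert (Lim1 : forall j, h (m j) / t (m j) + l <= (r * sqrt 2 + e j) * sqrt 2).
{ intros j.
  assert (LL : is_lim_seq (fun k => h (m j) / t (m j) + h (m k) / t (m k)
      - h (m j) * (t (m k) * cs (m j)) - h (m k) * cs (m j))
      (h (m j) / t (m j) + l - h (m j) * (0 * cs (m j)) - 0 * cs (m j))).
  { apply is_lim_seq_minus'; [apply is_lim_seq_minus'; [apply is_lim_seq_plus'|]|].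
    - apply is_lim_seq_const.
    - exact (Sub _ _ Ll).
    - apply is_lim_seq_mult'; [apply is_lim_seq_const|].
      apply is_lim_seq_mult'; [exact (Sub _ _ Ls) | apply is_lim_seq_const].
    - apply is_lim_seq_mult'; [exact (Sub _ _ Lp) | apply is_lim_seq_const]. }
  assert (LR : is_lim_seq (fun k => (r * (sqrt 2 * (1 + t (m k) * cs (m j))) + (e j + e k))
      * (sqrt 2 * (1 + h (m k) * cp (m j))))
      ((r * (sqrt 2 * (1 + 0 * cs (m j))) + (e j + 0)) * (sqrt 2 * (1 + 0 * cp (m j))))).
  { apply is_lim_seq_mult'; [apply is_lim_seq_plus'|].
    - apply is_lim_seq_mult'; [apply is_lim_seq_const|].
      apply is_lim_seq_mult'; [apply is_lim_seq_const|].
      apply is_lim_seq_plus'; [apply is_lim_seq_const|].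
      apply is_lim_seq_mult'; [exact (Sub _ _ Ls) | apply is_lim_seq_const].
    - apply is_lim_seq_plus'; [apply is_lim_seq_const | exact Le].
    - apply is_lim_seq_mult'; [apply is_lim_seq_const|].
      apply is_lim_seq_plus'; [apply is_lim_seq_const|].
      apply is_lim_seq_mult'; [exact (Sub _ _ Lp) | apply is_lim_seq_const]. }
  assert (Main' : forall k, h (m j) / t (m j) + h (m k) / t (m k)
      - h (m j) * (t (m k) * cs (m j)) - h (m k) * cs (m j) <=
      (r * (sqrt 2 * (1 + t (m k) * cs (m j))) + (e j + e k))
      * (sqrt 2 * (1 + h (m k) * cp (m j)))).
  { intros k; apply Rle_trans with (1 := Main (m j) (m k)).
    apply Rmult_le_compat_r; [|apply Rplus_le_compat_l, Tri].
    apply Rmult_le_pos; [exact S2|].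
    assert (0 <= h (m k) * cp (m j)).
    { apply Rmult_le_pos; [apply sqrt_pos|].
      apply Rlt_le, Rinv_0_lt_compat; pose proof (Hp (m j)) as Q; unfold disk in Q; lra. }
    lra. }
  assert (H := is_lim_seq_le _ _ _ _ Main' LL LR).
  simpl in H; lra. }
assert (LL : is_lim_seq (fun j => h (m j) / t (m j) + l) (l + l)).
{ apply is_lim_seq_plus'; [exact (Sub _ _ Ll) | apply is_lim_seq_const]. }
assert (LR : is_lim_seq (fun j => (r * sqrt 2 + e j) * sqrt 2) ((r * sqrt 2 + 0) * sqrt 2)).
{ apply is_lim_seq_mult'; [|apply is_lim_seq_const].
  apply is_lim_seq_plus'; [apply is_lim_seq_const | exact Le]. }
assert (H := is_lim_seq_le _ _ _ _ Lim1 LL LR); simpl in H; simpl.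
replace ((r * sqrt 2 + 0) * sqrt 2) with (r * (sqrt 2 * sqrt 2)) in H by ring.
rewrite S22 in H; lra.
Qed.

(** * The right half-plane *)

(** The point of the disk that corresponds to the point [w] of the right half-plane
    under the Cayley transform. *)
Definition point (w : R) : C := RtoC ((w - 1) / (w + 1)).

(** In the half-plane, [linfrac q d] is the map [w |-> (w + beta d) / q - 1],
    whose image is bounded by the line where the real part is
    [(Re (beta d) - q) / q]. *)
Definition beta (d : C) : C := ((d - 1) / (d + 1))%C.

Lemma point_disk w : 0 < w -> disk (point w).
Proof.
intros Hw; unfold disk, point; rewrite Cmod_R; apply Rabs_def1.
- apply Rlt_div_l; lra.
- apply Rlt_div_r; lra.
Qed.

Lemma beta_eq d : 1 < Cmod d ->
  beta d = ((Cmod d ^ 2 - 1) / Cmod (1 + d)%C ^ 2, 2 * Im d / Cmod (1 + d)%C ^ 2).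
Proof.
intros Hd; pose proof (Cmod_one_plus_pos d Hd) as P.
assert (N : Cmod (1 + d)%C ^ 2 <> 0) by (apply pow_nonzero; lra).
rewrite !Cmod2_alt in *; destruct d as [x y]; unfold beta; simpl in N |- *.
apply injective_projections; simpl; field; intros E; apply N; lra.
Qed.

Lemma Re_beta q d : 0 < q -> 1 < Cmod d -> Re (beta d) = q / radius q d.
Proof.
intros Hq Hd; rewrite beta_eq by exact Hd; unfold radius; cbn [Re fst].
pose proof (Cmod_sq_gt_1 d Hd); pose proof (Cmod_one_plus_pos d Hd); field; lra.
Qed.

Lemma Re_beta_pos d : 1 < Cmod d -> 0 < Re (beta d).
Proof.
intros Hd; rewrite beta_eq by exact Hd; cbn [Re fst].
apply Rdiv_lt_0_compat; [now apply Cmod_sq_gt_1 | now apply pow_lt, Cmod_one_plus_pos].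
Qed.

Lemma plus_beta_neq_0 w d : 0 < w -> 1 < Cmod d -> (RtoC w + beta d)%C <> RtoC 0.
Proof.
intros Hw Hd E; apply (f_equal Re) in E; pose proof (Re_beta_pos d Hd); rewrite re_plus in E.
change (w + Re (beta d) = 0) in E; lra.
Qed.

Lemma linfrac_point q d w : 0 < w -> 1 < Cmod d ->
  linfrac q d (point w) = (1 - 2 * RtoC q / (RtoC w + beta d))%C.
Proof.
intros Hw Hd; pose proof (plus_beta_neq_0 w d Hw Hd) as N.
pose proof (one_plus_neq_0 d Hd) as N1.
pose proof (disk_plus_neq_0 d _ Hd (point_disk w Hw)) as N2.
assert (N3 : RtoC (w + 1) <> RtoC 0) by (intros E; apply RtoC_inj in E; lra).
unfold linfrac, point, beta in *.
rewrite RtoC_div, RtoC_minus, RtoC_plus in * by lra.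
rewrite Cplus_comm in N1.
assert (E1 : ((RtoC w - 1) / (RtoC w + 1) + d = (RtoC w * (d + 1) + (d - 1)) / (RtoC w + 1))%C)
  by (field; assumption).
assert (E2 : (RtoC w + (d - 1) / (d + 1) = (RtoC w * (d + 1) + (d - 1)) / (d + 1))%C)
  by (field; assumption).
assert (N4 : (RtoC w * (d + 1) + (d - 1))%C <> RtoC 0).
{ intros E; apply N; rewrite E2, E; field; assumption. }
rewrite E1, E2; field; repeat split; assumption.
Qed.

(** The inverse of the value at [point w] of the kernel at [point v]. *)
Lemma point_gram v w : 0 < v -> 0 < w ->
  (1 - Cconj (point v) * point w)%C = RtoC (2 * (v + w) / ((v + 1) * (w + 1))).
Proof.
intros Hv Hw; unfold point; apply injective_projections; simpl; [field; lra | ring].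
Qed.

(** The same for the images of the two points. *)
Lemma linfrac_gram q d v w : 0 < q -> 0 < v -> 0 < w -> 1 < Cmod d ->
  (1 - Cconj (linfrac q d (point v)) * linfrac q d (point w))%C =
  (2 * RtoC q * RtoC (v + w + 2 * (Re (beta d) - q))
    / ((RtoC v + Cconj (beta d)) * (RtoC w + beta d)))%C.
Proof.
intros Hq Hv Hw Hd; rewrite !linfrac_point by assumption.
pose proof (plus_beta_neq_0 v d Hv Hd) as N1; pose proof (plus_beta_neq_0 w d Hw Hd) as N2.
assert (N1' : (RtoC v + Cconj (beta d))%C <> RtoC 0).
{ intros E; apply N1; rewrite <- (Cconj_conj (_ + _)), Cplus_conj.
  rewrite Cconj_RtoC.
  rewrite E; apply Cconj_RtoC. }
rewrite Cminus_conj, Cdiv_conj, Cmult_conj, Cplus_conj by exact N1.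
rewrite !Cconj_RtoC.
replace (RtoC (v + w + 2 * (Re (beta d) - q))) with
  (RtoC v + RtoC w + (beta d + Cconj (beta d)) - 2 * RtoC q)%C.
2: { apply injective_projections; destruct (beta d); simpl; ring. }
field; split; assumption.
Qed.

(** * The radial limit *)

Lemma Cconj_self_sq (u : C) : (1 - Cconj u * u)%C = RtoC (1 - Cmod u ^ 2).
Proof. rewrite RtoC_minus, Cmod2_conj; ring. Qed.

Lemma height_point w : 0 < w -> height (point w) = sqrt (4 * w / (w + 1) ^ 2).
Proof.
intros Hw; unfold height; f_equal; apply RtoC_inj.
rewrite <- Cconj_self_sq, point_gram by assumption; f_equal; field; lra.
Qed.

Lemma height_linfrac q d w : 0 < q -> 0 < w -> 1 < Cmod d ->
  height (linfrac q d (point w)) =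
  sqrt (4 * q * (w + (Re (beta d) - q)) / ((w + Re (beta d)) ^ 2 + Im (beta d) ^ 2)).
Proof.
intros Hq Hw Hd; unfold height; f_equal; apply RtoC_inj.
pose proof (Re_beta_pos d Hd) as P; pose proof (plus_beta_neq_0 w d Hw Hd) as N.
assert (P2 : 0 < (w + Re (beta d)) ^ 2 + Im (beta d) ^ 2)
  by (pose proof (pow2_ge_0 (Im (beta d))); assert (0 < (w + Re (beta d)) ^ 2) by (apply pow_lt; lra); lra).
rewrite <- Cconj_self_sq, linfrac_gram by assumption.
replace ((RtoC w + Cconj (beta d)) * (RtoC w + beta d))%C with
  (RtoC ((w + Re (beta d)) ^ 2 + Im (beta d) ^ 2))
  by (apply injective_projections; destruct (beta d); simpl; ring).
rewrite <- !RtoC_mult, <- RtoC_div by lra; f_equal; field; lra.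
Qed.

Lemma is_lim_seq_at_0 (F : R -> R) : ex_derive F 0 ->
  is_lim_seq (fun n => F (/ (INR n + 1))) (F 0).
Proof.
intros HF; apply is_lim_seq_continuous.
- apply derivable_continuous_pt, ex_derive_Reals_0, HF.
- apply is_lim_seq_ext with (fun n => / INR (S n)); [intros n; now rewrite S_INR|].
  apply (is_lim_seq_incr_1 (fun n => / INR n)).
  apply (is_lim_seq_inv _ p_infty); [apply is_lim_seq_INR | easy].
Qed.

Lemma ess_norm_comp_ge (q : R) (d : C) : 0 < q -> 1 < Cmod d ->
  radius q d <= 1 -> disk_self_map (linfrac q d) ->
  Rbar_le (Finite (sqrt (/ q))) (ess_norm (comp_op (linfrac q d))).
Proof.
intros Hq Hd Hr hself.
set (w := fun n => INR n + 1).
assert (Hw : forall n, 0 < w n) by (intros n; unfold w; pose proof (pos_INR n); lra).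
pose proof (Re_beta_pos d Hd) as Pb; pose proof (radius_pos q d Hq Hd) as Pr.
assert (Pc : 0 <= Re (beta d) - q).
{ rewrite (Re_beta q) by assumption; apply Rge_le, Rge_minus, Rle_ge.
  apply Rle_div_r; [exact Pr|]; nra. }
set (a := Re (beta d)) in *; set (b := Im (beta d)).
assert (Hi : forall n, / w n = / (INR n + 1)) by reflexivity.
apply (ess_norm_ge (comp_op (linfrac q d)) (fun n => point (w n))
  (fun n => linfrac q d (point (w n))) _ (fun n => point_disk _ (Hw n))
  (fun n => hself _ (point_disk _ (Hw n)))).
- intros c x; now apply comp_op_scal.
- intros f n; apply comp_op_val; try assumption; apply point_disk, Hw.
- apply is_lim_seq_ext with (fun n => sqrt ((fun u => 4 * u / (1 + u) ^ 2) (/ (INR n + 1)))).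
  + intros n; rewrite height_point by apply Hw; f_equal; rewrite <- Hi.
    specialize (Hw n); field; lra.
  + replace (Finite 0) with (Finite (sqrt ((fun u => 4 * u / (1 + u) ^ 2) 0)))
      by (cbv beta; f_equal; transitivity (sqrt 0); [f_equal; field | apply sqrt_0]).
    apply is_lim_seq_continuous; [apply continuity_pt_sqrt, Req_le; field|].
    apply (is_lim_seq_at_0 (fun u => 4 * u / (1 + u) ^ 2)); auto_derive; lra.
- apply is_lim_seq_ext with (fun n => sqrt ((fun u =>
     4 * q * u * (1 + (a - q) * u) / ((1 + a * u) ^ 2 + (b * u) ^ 2)) (/ (INR n + 1)))).
  + intros n; rewrite height_linfrac by (try apply Hw; assumption); fold a b; f_equal; rewrite <- Hi.
    specialize (Hw n).
    assert (0 < (w n + a) ^ 2) by (apply pow_lt; lra); pose proof (pow2_ge_0 b).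
    field; repeat split; lra.
  + replace (Finite 0) with (Finite (sqrt ((fun u =>
     4 * q * u * (1 + (a - q) * u) / ((1 + a * u) ^ 2 + (b * u) ^ 2)) 0)))
      by (cbv beta; f_equal; transitivity (sqrt 0); [f_equal; field | apply sqrt_0]).
    apply is_lim_seq_continuous; [apply continuity_pt_sqrt, Req_le; field|].
    apply (is_lim_seq_at_0 (fun u =>
     4 * q * u * (1 + (a - q) * u) / ((1 + a * u) ^ 2 + (b * u) ^ 2))); auto_derive; lra.
- apply is_lim_seq_ext with (fun n => sqrt ((fun u =>
     ((1 + a * u) ^ 2 + (b * u) ^ 2) / (q * (1 + u) ^ 2 * (1 + (a - q) * u))) (/ (INR n + 1)))).
  + intros n; rewrite height_point, height_linfrac by (try apply Hw; assumption); fold a b.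
    specialize (Hw n).
    assert (0 < (w n + a) ^ 2) by (apply pow_lt; lra); pose proof (pow2_ge_0 b).
    rewrite <- sqrt_div_alt.
    * f_equal; rewrite <- Hi; field; repeat split; lra.
    * apply Rdiv_lt_0_compat; [|lra]; apply Rmult_lt_0_compat; lra.
  + replace (/ q) with ((fun u =>
     ((1 + a * u) ^ 2 + (b * u) ^ 2) / (q * (1 + u) ^ 2 * (1 + (a - q) * u))) 0) by (field; lra).
    apply is_lim_seq_continuous.
    { apply continuity_pt_sqrt; apply Rlt_le; replace (_ / _) with (/ q) by (field; lra).
      now apply Rinv_0_lt_compat. }
    apply (is_lim_seq_at_0 (fun u =>
     ((1 + a * u) ^ 2 + (b * u) ^ 2) / (q * (1 + u) ^ 2 * (1 + (a - q) * u)))); auto_derive; lra.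
Qed.

(** * The kernel of [1 / q - C C^*] on a geometric progression *)

Lemma inner_lincomb_r (h : H2) x s n :
  H2_inner h (lincomb x s n) = sum_n (fun k => Cconj (x k) * H2_inner h (s k))%C n.
Proof.
induction n as [|n IH].
- rewrite lincomb_0, sum_O; apply inner_scal_r.
- rewrite lincomb_S, sum_Sn, inner_plus_r, IH, inner_scal_r; reflexivity.
Qed.

(** The sum of [F j k] over [j, k <= n]. *)
Definition dsum (F : nat -> nat -> R) (n : nat) : R :=
  sum_n (fun k => sum_n (fun j => F j k) n) n.

(** The real part of [z] times
    [(v + 1) (w + 1) / (v + w) - (v + conj beta) (w + beta) / (v + w + 2 c)], where
    [beta = a + i b].  For [c = a - q] the latter is [2 q] times the value of the
    kernel of [1 / q - C C^*] at [point v] and [point w]. *)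
Definition gram_defect (a b c v w : R) (z : C) : R :=
  Re z * ((v + 1) * (w + 1) / (v + w)
          - (v * w + a * (v + w) + a ^ 2 + b ^ 2) / (v + w + 2 * c))
  + Im z * (b * (v - w) / (v + w + 2 * c)).

Lemma lincomb_kernel_norm2 (x : nat -> C) (p : nat -> C) (Hp : forall n, disk (p n)) n :
  H2_norm (lincomb x (fun k => kernel (p k) (Hp k)) n) ^ 2 =
  dsum (fun j k => Re (x j * Cconj (x k) * / (1 - Cconj (p j) * p k))%C) n.
Proof.
set (G := lincomb _ _ n).
change (H2_norm G ^ 2) with (Re (RtoC (H2_norm G ^ 2))).
rewrite <- inner_self; unfold G at 2; rewrite inner_lincomb_r, sum_n_Re.
unfold dsum; apply sum_n_ext; intros k.
rewrite reproducing; unfold G; rewrite lincomb_val.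
rewrite <- sum_n_Re; f_equal.
rewrite <- (sum_n_mult_l (K := C_Ring)); apply sum_n_ext; intros j.
change (Cconj (x k) * (x j * kernel (p j) (Hp j) (p k)) =
  x j * Cconj (x k) * / (1 - Cconj (p j) * p k))%C.
rewrite kernel_val by apply Hp; ring.
Qed.

(** If [C] has norm at most [1 / sqrt q], then [1 / q - C C^*] is positive on
    the combinations of kernels: if [C^*] sends [G] to [F], then
    [||F||^2 = <C F, G> <= ||F|| ||G|| / sqrt q]. *)
Lemma gram_defect_pos (q : R) (d : C) (x : nat -> C) (w : nat -> R) n :
  0 < q -> 1 < Cmod d -> radius q d <= 1 -> disk_self_map (linfrac q d) ->
  (forall f, H2_norm (comp_op (linfrac q d) f) <= sqrt (/ q) * H2_norm f) ->
  (forall k, 0 < w k) ->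
  0 <= dsum (fun j k => gram_defect (Re (beta d)) (Im (beta d)) (Re (beta d) - q)
                          (w j) (w k) (x j * Cconj (x k))%C) n.
Proof.
intros Hq Hd Hr hself HB Hw.
set (Hp := fun k => point_disk (w k) (Hw k)).
set (Hs := fun k => hself (point (w k)) (Hp k)).
set (G := lincomb x (fun k => kernel _ (Hp k)) n).
set (F := lincomb x (fun k => kernel _ (Hs k)) n).
assert (E : Re (H2_inner (comp_op (linfrac q d) F) G) = H2_norm F ^ 2).
{ change (H2_norm F ^ 2) with (Re (RtoC (H2_norm F ^ 2))); rewrite <- inner_self.
  unfold G; unfold F at 3; rewrite !inner_lincomb_r; f_equal; apply sum_n_ext; intros k.
  rewrite !reproducing; f_equal; apply comp_op_val; try assumption; apply Hp. }
assert (L : q * H2_norm F ^ 2 <= H2_norm G ^ 2).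
{ pose proof (Re_inner_le (comp_op (linfrac q d) F) G) as I; rewrite E in I.
  specialize (HB F); pose proof (H2_norm_ge_0 F) as P1; pose proof (H2_norm_ge_0 G) as P2.
  assert (Q : H2_norm F <= sqrt (/ q) * H2_norm G).
  { destruct (Req_dec (H2_norm F) 0) as [->|N].
    - apply Rmult_le_pos; [apply sqrt_pos | exact P2].
    - apply Rmult_le_reg_l with (H2_norm F); [lra|].
      replace (H2_norm F * (sqrt (/ q) * H2_norm G)) with (sqrt (/ q) * H2_norm F * H2_norm G) by ring.
      apply Rle_trans with (H2_norm F ^ 2); [lra|].
      apply Rle_trans with (1 := I), Rmult_le_compat_r; assumption. }
  apply Rle_trans with (q * (sqrt (/ q) * H2_norm G) ^ 2).
  - apply Rmult_le_compat_l; [lra|]; apply pow_incr; lra.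
  - rewrite Rpow_mult_distr, pow2_sqrt by (apply Rlt_le, Rinv_0_lt_compat, Hq).
    apply Req_le; field; lra. }
unfold F, G in L; rewrite !lincomb_kernel_norm2 in L.
assert (E2 : dsum (fun j k => gram_defect (Re (beta d)) (Im (beta d)) (Re (beta d) - q)
   (w j) (w k) (x j * Cconj (x k))%C) n =
   2 * (dsum (fun j k => Re (x j * Cconj (x k) * / (1 - Cconj (point (w j)) * point (w k)))%C) n
   - q * dsum (fun j k => Re (x j * Cconj (x k) *
      / (1 - Cconj (linfrac q d (point (w j))) * linfrac q d (point (w k))))%C) n)); [|lra].
assert (Lin : forall (A B : nat -> nat -> R) u v m l,
  sum_n (fun k => sum_n (fun j => u * (A j k - v * B j k)) l) m =
  u * (sum_n (fun k => sum_n (fun j => A j k) l) m - v * sum_n (fun k => sum_n (fun j => B j k) l) m)).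
{ intros A B u v m l.
  assert (Lin1 : forall (A B : nat -> R) m,
     sum_n (fun k => u * (A k - v * B k)) m = u * (sum_n A m - v * sum_n B m)).
  { clear; intros A B m; induction m as [|m IH]; [now rewrite !sum_O|].
    rewrite !sum_Sn, IH; change (plus ?x ?y) with (x + y); lra. }
  rewrite <- Lin1; apply sum_n_ext; intros k; apply Lin1. }
unfold dsum; rewrite <- Lin; apply sum_n_ext; intros k; apply sum_n_ext; intros j.
pose proof (Re_beta_pos d Hd) as Pb; pose proof (radius_pos q d Hq Hd) as Pr.
assert (Pc : 0 <= Re (beta d) - q).
{ rewrite (Re_beta q) by assumption; apply Rge_le, Rge_minus, Rle_ge.
  apply Rle_div_r; [exact Pr|]; nra. }
pose proof (Hw j) as Pj; pose proof (Hw k) as Pk.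
rewrite point_gram, linfrac_gram by assumption.
set (z := (x j * Cconj (x k))%C); set (v := w j) in *; set (u := w k) in *.
set (c := Re (beta d) - q) in *.
pose proof (plus_beta_neq_0 v d Pj Hd) as N1; pose proof (plus_beta_neq_0 u d Pk Hd) as N2.
assert (N1' : (RtoC v + Cconj (beta d))%C <> RtoC 0).
{ intros E'; apply (f_equal Re) in E'; rewrite re_plus, re_conj in E'.
  change (v + Re (beta d) = 0) in E'; lra. }
assert (Nq : RtoC q <> RtoC 0) by (intros E'; apply RtoC_inj in E'; lra).
assert (Nc : RtoC (v + u + 2 * c) <> RtoC 0) by (intros E'; apply RtoC_inj in E'; lra).
replace (/ (2 * RtoC q * RtoC (v + u + 2 * c) / ((RtoC v + Cconj (beta d)) * (RtoC u + beta d))))%C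
  with (RtoC (/ (2 * q * (v + u + 2 * c))) * ((RtoC v + Cconj (beta d)) * (RtoC u + beta d)))%C.
2: { rewrite RtoC_inv, !RtoC_mult by nra; field; repeat split; assumption. }
rewrite <- RtoC_inv by (apply Rgt_not_eq, Rdiv_lt_0_compat; nra).
unfold gram_defect; destruct (beta d) as [a b], z as [s t].
unfold Cconj, Cplus, Cmult, RtoC, Re, Im; cbn [fst snd].
match goal with |- ?l = ?r => change (@eq R l r) end.
field; repeat split; nra.
Qed.

Lemma is_lim_seq_dsum (F : nat -> nat -> nat -> R) (l : nat -> nat -> R) n :
  (forall j k, is_lim_seq (fun T => F T j k) (l j k)) ->
  is_lim_seq (fun T => dsum (F T) n) (dsum l n).
Proof.
intros H; unfold dsum.
apply (is_lim_seq_sum_n (fun T k => sum_n (fun j => F T j k) n)); intros k.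
apply (is_lim_seq_sum_n (fun T j => F T j k)); intros j; apply H.
Qed.

(** The sign of [j - k]. *)
Definition sgn (j k : nat) : R := if lt_dec j k then -1 else if lt_dec k j then 1 else 0.

(** The Kronecker symbol. *)
Definition eqn (j k : nat) : R := if Nat.eq_dec j k then 1 else 0.

(** The limit of [gram_defect] when [v] and [w] are two terms of a geometric
    progression whose ratio goes to infinity. *)
Definition limit_defect (a b c : R) (j k : nat) (z : C) : R :=
  Re z * (1 - a + eqn j k * (c / 2)) + Im z * (b * sgn j k).

Lemma is_lim_seq_inv_pow (i : nat) :
  is_lim_seq (fun T => / (INR T + 1) ^ S i) 0.
Proof.
assert (L : is_lim_seq (fun T => / (INR T + 1)) 0)
  by (apply (is_lim_seq_at_0 (fun u => u)); auto_derive; exact I).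
induction i as [|i IH].
- apply is_lim_seq_ext with (2 := L); intros T; now rewrite pow_1.
- apply is_lim_seq_ext with (fun T => / (INR T + 1) * / (INR T + 1) ^ S i).
  + intros T; pose proof (pos_INR T); simpl; field; split; [apply pow_nonzero|]; lra.
  + replace (Finite 0) with (Finite (0 * 0)) by (f_equal; ring); now apply is_lim_seq_mult'.
Qed.

Lemma limit_defect_correct (a b c : R) (j k : nat) (z : C) : 0 <= c ->
  is_lim_seq (fun T => gram_defect a b c ((INR T + 1) ^ S j) ((INR T + 1) ^ S k) z)
    (limit_defect a b c j k z).
Proof.
intros Hc.
(* the symmetric and the antisymmetric part, in terms of [1 / v] and [w / v] *)
set (Fs := fun u r => ((1 - a) * (1 + r) ^ 2 + 2 * c * r + 2 * c * u * (1 + r)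
   + (1 - (a ^ 2 + b ^ 2)) * u * (1 + r) + 2 * c * u ^ 2) / ((1 + r) * (1 + r + 2 * c * u))).
set (Fa := fun u r => b * (1 - r) / (1 + r + 2 * c * u)).
assert (ED : forall v w z, 0 < v -> 0 < w ->
   gram_defect a b c v w z = Re z * Fs (/ v) (w / v) + Im z * Fa (/ v) (w / v)).
{ intros v w z' Hv Hw; unfold gram_defect, Fs, Fa; field; repeat split; nra. }
assert (Sym : forall v w z, gram_defect a b c v w z = gram_defect a b c w v (Cconj z)).
{ intros v w z'; unfold gram_defect; rewrite re_conj, im_conj.
  rewrite (Rplus_comm w v), (Rmult_comm w v), (Rmult_comm (w + 1)).
  unfold Rdiv; ring. }
assert (LF : forall (u r : nat -> R) l, 0 <= l -> is_lim_seq u 0 -> is_lim_seq r l ->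
   forall z, is_lim_seq (fun T => Re z * Fs (u T) (r T) + Im z * Fa (u T) (r T))
     (Re z * Fs 0 l + Im z * Fa 0 l)).
{ intros u r l Hl Lu Lr z'; unfold Fs, Fa.
  repeat match goal with
  | |- is_lim_seq (fun T => _ / _) _ => apply is_lim_seq_div'
  | |- is_lim_seq (fun T => _ + _) _ => apply is_lim_seq_plus'
  | |- is_lim_seq (fun T => _ - _) _ => apply is_lim_seq_minus'
  | |- is_lim_seq (fun T => _ * _) _ => apply is_lim_seq_mult'
  | |- is_lim_seq (fun T => _ ^ _) _ => simpl
  | |- is_lim_seq u _ => exact Lu
  | |- is_lim_seq r _ => exact Lr
  | |- is_lim_seq (fun T => _) _ => apply is_lim_seq_const
  end; rewrite Rmult_0_r; try apply Rmult_integral_contrapositive_currified; lra. }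
assert (PT : forall T i, 0 < (INR T + 1) ^ i)
  by (intros T i; apply pow_lt; pose proof (pos_INR T); lra).
assert (Gt : forall m i z, is_lim_seq (fun T => gram_defect a b c ((INR T + 1) ^ S (m + S i)) ((INR T + 1) ^ S m) z)
   (Re z * Fs 0 0 + Im z * Fa 0 0)).
{ intros m i z'.
  apply is_lim_seq_ext with (fun T => Re z' * Fs (/ (INR T + 1) ^ S (m + S i)) (/ (INR T + 1) ^ S i)
     + Im z' * Fa (/ (INR T + 1) ^ S (m + S i)) (/ (INR T + 1) ^ S i)).
  - intros T; rewrite ED by apply PT.
    replace ((INR T + 1) ^ S m / (INR T + 1) ^ S (m + S i)) with (/ (INR T + 1) ^ S i); [reflexivity|].
    replace (S (m + S i)) with (S m + S i)%nat by lia; rewrite pow_add.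
    pose proof (PT T (S m)); pose proof (PT T (S i)); field; lra.
  - apply LF; [lra | apply is_lim_seq_inv_pow | apply is_lim_seq_inv_pow]. }
unfold limit_defect, sgn, eqn.
destruct (lt_dec j k) as [Hjk|Hjk]; [|destruct (lt_dec k j) as [Hkj|Hkj]];
  destruct (Nat.eq_dec j k) as [E|E]; try lia.
- apply is_lim_seq_ext with (fun T => gram_defect a b c
    ((INR T + 1) ^ S (j + S (k - S j))) ((INR T + 1) ^ S j) (Cconj z)).
  + intros T; replace (j + S (k - S j))%nat with k by lia; symmetry; apply Sym.
  + match goal with |- is_lim_seq _ (Finite ?l) =>
      replace l with (Re (Cconj z) * Fs 0 0 + Im (Cconj z) * Fa 0 0) end; [apply Gt|].
    rewrite re_conj, im_conj; unfold Fs, Fa; field.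
- apply is_lim_seq_ext with (fun T => gram_defect a b c
    ((INR T + 1) ^ S (k + S (j - S k))) ((INR T + 1) ^ S k) z).
  + intros T; now replace (k + S (j - S k))%nat with j by lia.
  + match goal with |- is_lim_seq _ (Finite ?l) =>
      replace l with (Re z * Fs 0 0 + Im z * Fa 0 0) end; [apply Gt|].
    unfold Fs, Fa; field.
- subst k.
  apply is_lim_seq_ext with (fun T => Re z * Fs (/ (INR T + 1) ^ S j) 1
     + Im z * Fa (/ (INR T + 1) ^ S j) 1).
  + intros T; rewrite ED by apply PT; pose proof (PT T (S j)).
    replace ((INR T + 1) ^ S j / (INR T + 1) ^ S j) with 1 by (field; lra); reflexivity.
  + match goal with |- is_lim_seq _ (Finite ?l) =>
      replace l with (Re z * Fs 0 1 + Im z * Fa 0 1) end.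
    * apply (LF _ (fun _ => 1)); [lra | apply is_lim_seq_inv_pow | apply is_lim_seq_const].
    * unfold Fs, Fa; field.
Qed.

Lemma dsum_S (F : nat -> nat -> R) n :
  dsum F (S n) = dsum F n + sum_n (fun k => F (S n) k + F k (S n)) n + F (S n) (S n).
Proof.
unfold dsum; rewrite sum_Sn, (sum_Sn (fun j => F j (S n))).
rewrite (sum_n_ext (fun k => sum_n (fun j => F j k) (S n))
  (fun k => plus (sum_n (fun j => F j k) n) (F (S n) k))) by (intros k; apply sum_Sn).
rewrite (sum_n_plus (G := R_AbelianMonoid)).
rewrite (sum_n_plus (G := R_AbelianMonoid) (fun k => F (S n) k) (fun k => F k (S n))).
repeat change (plus ?x ?y) with (x + y); change (sum_n (fun k => F (S n) k) n) with (sum_n (F (S n)) n); lra.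
Qed.

(** Twice the signed area swept, as seen from its origin, by the polygonal path
    with the successive edges [x 0, ..., x n]. *)
Fixpoint area (x : nat -> C) (n : nat) : R :=
  match n with
  | O => 0
  | S m => area x m + Im (x n * Cconj (sum_n x m))%C
  end.

Lemma dsum_limit_defect (a b c : R) (x : nat -> C) n :
  dsum (fun j k => limit_defect a b c j k (x j * Cconj (x k))%C) n =
  (1 - a) * Cmod (sum_n x n) ^ 2 + c / 2 * sum_n (fun k => Cmod (x k) ^ 2) n
  + 2 * b * area x n.
Proof.
assert (Dg : forall j, limit_defect a b c j j (x j * Cconj (x j))%C
   = (1 - a + c / 2) * Cmod (x j) ^ 2).
{ intros j; rewrite <- Cmod2_conj; unfold limit_defect, eqn, sgn.
  destruct (lt_dec j j); [lia|]; destruct (Nat.eq_dec j j); [|lia].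
  change (Re (RtoC ?u)) with u; change (Im (RtoC ?u)) with 0; lra. }
induction n as [|n IH].
- unfold dsum; rewrite !sum_O, Dg; simpl area; lra.
- rewrite dsum_S, IH, Dg, !sum_Sn; cbn [area].
  assert (Cr : sum_n (fun k => limit_defect a b c (S n) k (x (S n) * Cconj (x k))%C
       + limit_defect a b c k (S n) (x k * Cconj (x (S n)))%C) n
     = 2 * (1 - a) * Re (x (S n) * Cconj (sum_n x n))%C + 2 * b * Im (x (S n) * Cconj (sum_n x n))%C).
  { assert (G : forall m, (m <= n)%nat ->
      sum_n (fun k => limit_defect a b c (S n) k (x (S n) * Cconj (x k))%C
       + limit_defect a b c k (S n) (x k * Cconj (x (S n)))%C) m
     = 2 * (1 - a) * Re (x (S n) * Cconj (sum_n x m))%C + 2 * b * Im (x (S n) * Cconj (sum_n x m))%C).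
    { assert (T : forall k, (k <= n)%nat -> limit_defect a b c (S n) k (x (S n) * Cconj (x k))%C
         + limit_defect a b c k (S n) (x k * Cconj (x (S n)))%C =
         2 * (1 - a) * Re (x (S n) * Cconj (x k))%C + 2 * b * Im (x (S n) * Cconj (x k))%C).
      { intros k Hk; unfold limit_defect, eqn, sgn.
        destruct (lt_dec (S n) k), (lt_dec k (S n)), (Nat.eq_dec (S n) k), (Nat.eq_dec k (S n)); try lia.
        destruct (x (S n)), (x k); simpl; ring. }
      induction m as [|m IHm]; intros Hm; [rewrite !sum_O; now apply T|].
      rewrite !sum_Sn, IHm, T by lia; change (plus ?u ?v) with (u + v)%R at 1.
      change (plus (sum_n x m) (x (S m))) with (sum_n x m + x (S m))%C.
      destruct (x (S n)), (x (S m)), (sum_n x m); simpl; ring. }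
    now apply G. }
  rewrite Cr; change (plus (sum_n x n) (x (S n))) with (sum_n x n + x (S n))%C.
  repeat change (plus ?u ?v) with (u + v).
  assert (Ex : Cmod (sum_n x n + x (S n))%C ^ 2 = Cmod (sum_n x n) ^ 2 + Cmod (x (S n)) ^ 2
     + 2 * Re (x (S n) * Cconj (sum_n x n))%C).
  { rewrite !Cmod2_alt; destruct (x (S n)), (sum_n x n); simpl; ring. }
  rewrite Ex; lra.
Qed.

(** The effect of a block of [l] equal edges. *)
Lemma block (x : nat -> C) (e : C) m l :
  (forall i, (m < i <= m + l)%nat -> x i = e) ->
  sum_n x (m + l) = (sum_n x m + RtoC (INR l) * e)%C /\
  area x (m + l) = area x m + INR l * Im (e * Cconj (sum_n x m))%C /\
  sum_n (fun k => Cmod (x k) ^ 2) (m + l) = sum_n (fun k => Cmod (x k) ^ 2) m + INR l * Cmod e ^ 2.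
Proof.
induction l as [|l IH]; intros H.
- rewrite Nat.add_0_r; simpl INR; repeat split.
  + apply injective_projections; simpl; ring.
  + ring.
  + rewrite Rmult_0_l, Rplus_0_r; reflexivity.
- destruct IH as [I1 [I2 I3]]; [intros i Hi; apply H; lia|].
  rewrite Nat.add_succ_r, !sum_Sn; cbn [area]; rewrite I1, I2, I3, H, S_INR by lia.
  repeat split.
  + change (plus ?u ?v) with (u + v)%C; apply injective_projections; simpl; ring.
  + destruct (sum_n x m), e; simpl; ring.
  + change (plus ?u ?v) with (u + v)%R; lra.
Qed.

(** The norm of the composition operator exceeds [1 / sqrt q] unless [beta d]
    is real and at most [1]: otherwise the limiting quadratic form is negative
    along a long square path, respectively along a long straight path. *)
Lemma comp_norm_bound_beta (q : R) (d : C) : 0 < q -> 1 < Cmod d ->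
  radius q d <= 1 -> disk_self_map (linfrac q d) ->
  (forall f, H2_norm (comp_op (linfrac q d) f) <= sqrt (/ q) * H2_norm f) ->
  Im (beta d) = 0 /\ Re (beta d) <= 1.
Proof.
intros Hq Hd Hr hself HB.
set (a := Re (beta d)); set (b := Im (beta d)); set (c := a - q).
assert (Pc : 0 <= c).
{ pose proof (radius_pos q d Hq Hd); unfold c, a; rewrite (Re_beta q) by assumption.
  apply Rge_le, Rge_minus, Rle_ge, Rle_div_r; nra. }
assert (Pos : forall x n, 0 <= (1 - a) * Cmod (sum_n x n) ^ 2
   + c / 2 * sum_n (fun k => Cmod (x k) ^ 2) n + 2 * b * area x n).
{ intros x n; rewrite <- dsum_limit_defect.
  assert (L : is_lim_seq (fun T => dsum (fun j k => gram_defect a b c ((INR T + 1) ^ S j)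
     ((INR T + 1) ^ S k) (x j * Cconj (x k))%C) n)
     (dsum (fun j k => limit_defect a b c j k (x j * Cconj (x k))%C) n)).
  { apply (is_lim_seq_dsum (fun T j k => gram_defect a b c ((INR T + 1) ^ S j)
     ((INR T + 1) ^ S k) (x j * Cconj (x k))%C)); intros j k; now apply limit_defect_correct. }
  refine (is_lim_seq_le _ _ _ _ _ (is_lim_seq_const 0) L); intros T.
  apply (gram_defect_pos q d x (fun k => (INR T + 1) ^ S k)); try assumption.
  intros k; apply pow_lt; pose proof (pos_INR T); lra. }
assert (Big : forall y, exists n, (0 < n)%nat /\ y < INR n).
{ intros y; destruct (INR_unbounded (Rmax y 0)) as [n Hn]; exists n.
  pose proof (Rmax_l y 0); pose proof (Rmax_r y 0); split; [apply INR_lt; simpl; lra | lra]. }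
assert (Eb : b = 0).
{ destruct (Req_dec b 0) as [|Nb]; [assumption|]; exfalso.
  set (sg := if Rlt_dec b 0 then 1 else -1).
  assert (Hsg : b * sg = - Rabs b).
  { unfold sg; destruct (Rlt_dec b 0); [rewrite Rabs_left by lra | rewrite Rabs_pos_eq by lra]; ring. }
  assert (Hsg2 : sg * sg = 1) by (unfold sg; destruct (Rlt_dec b 0); ring).
  assert (Pb : 0 < Rabs b) by now apply Rabs_pos_lt.
  destruct (Big (c / Rabs b)) as [n [Pn Hn]].
  (* a square with sides of [n] unit edges each, run through clockwise or
     counterclockwise according to the sign of [b]; the edge of index 0 is null *)
  set (u := fun i => match i with 0%nat => RtoC 1 | 1%nat => (0, sg) | 2%nat => RtoC (-1)
     | _ => (0, - sg) end : C).
  set (x := fun i => match i with O => RtoC 0 | S i => u (i / n)%nat end).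
  assert (Hx : forall t i, (t * n < i <= t * n + n)%nat -> x i = u t).
  { intros t i Hi; unfold x; destruct i as [|i]; [lia|]; f_equal.
    symmetry; apply (Nat.div_unique i n t (i - t * n)); lia. }
  destruct (block x (u 0%nat) 0 n) as [A1 [B1 C1]]; [intros i Hi; apply Hx; lia|].
  destruct (block x (u 1%nat) (0 + n) n) as [A2 [B2 C2]]; [intros i Hi; apply Hx; lia|].
  destruct (block x (u 2%nat) (0 + n + n) n) as [A3 [B3 C3]]; [intros i Hi; apply Hx; lia|].
  destruct (block x (u 3%nat) (0 + n + n + n) n) as [A4 [B4 C4]]; [intros i Hi; apply Hx; lia|].
  specialize (Pos x (0 + n + n + n + n)%nat).
  rewrite A4, B4, C4, A3, B3, C3, A2, B2, C2, A1, B1, C1, !sum_O in Pos.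
  set (N := INR n) in *.
  assert (EP : (x 0%nat + RtoC N * u 0%nat + RtoC N * u 1%nat + RtoC N * u 2%nat + RtoC N * u 3%nat = RtoC 0)%C)
    by (apply injective_projections; simpl; ring).
  rewrite EP, Cmod_0, !Cmod2_alt in Pos.
  unfold u, x in Pos; cbn [area] in Pos.
  unfold Cconj, Cplus, Cmult, RtoC, Re, Im in Pos; cbn [fst snd] in Pos.
  assert (E : 2 * b * (2 * (sg * N ^ 2)) + 2 * c * N < 0).
  { replace (2 * b * (2 * (sg * N ^ 2)) + 2 * c * N) with (2 * N * (2 * (b * sg) * N + c)) by ring.
    rewrite Hsg.
    assert (c < N * Rabs b) by (apply Rlt_div_l; assumption).
    assert (0 < N) by (apply (lt_INR 0); exact Pn).
    nra. }
  apply (Rlt_not_le _ _ E), Rle_trans with (1 := Pos), Req_le.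
  ring_simplify; replace (sg ^ 2) with 1 by (rewrite <- Hsg2; ring); field. }
split; [exact Eb|].
apply Rnot_lt_le; intros Ha.
(* a segment of [n] unit edges *)
destruct (Big (c / 2 / (a - 1))) as [n [Pn Hn]].
set (x := fun i => match i with O => RtoC 0 | S i => RtoC 1 end).
destruct (block x (RtoC 1) 0 n) as [A1 [B1 C1]]; [intros [|i] Hi; [lia | reflexivity]|].
specialize (Pos x (0 + n)%nat); rewrite A1, B1, C1, !sum_O, Eb in Pos.
set (N := INR n) in *.
assert (P : 0 < N) by (apply (lt_INR 0); exact Pn).
replace (x 0%nat + RtoC N * RtoC 1)%C with (RtoC N) in Pos
  by (unfold x; apply injective_projections; simpl; ring).
rewrite (Cmod_R N), (Rabs_pos_eq N), Cmod_1 in Pos by lra.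
unfold x in Pos; rewrite Cmod_0 in Pos.
assert (c / 2 < N * (a - 1)) by (apply Rlt_div_l in Hn; lra).
nra.
Qed.

(** * Norm and essential norm *)

Theorem theorem4p4 (q : R) (d : C) (hq : 0 < q) (hd : 1 < Cmod d)
    (hself : disk_self_map (linfrac q d))
    (hnaut : ~ disk_automorphism (linfrac q d)) :
  op_norm (comp_op (linfrac q d)) = ess_norm (comp_op (linfrac q d)) <->
  (Im d = 0 /\ 1 < Re d).
Proof.
pose proof (radius_lt_1 q d hq hd hself hnaut) as Hr.
assert (Hr' : radius q d <= 1) by lra.
pose proof (ess_norm_comp_le q d hq hd Hr hself) as Upper.
assert (Hom : forall c x, comp_op (linfrac q d) (scal c x) = scal c (comp_op (linfrac q d) x))
  by (intros c x; now apply comp_op_scal).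
split.
- intros E; rewrite <- E in Upper.
  destruct (comp_norm_bound_beta q d hq hd Hr' hself) as [B1 B2];
    [now apply op_norm_bound|].
  rewrite beta_eq in B1, B2 by exact hd; cbn [Re Im fst snd] in B1, B2.
  pose proof (Cmod_one_plus_pos d hd) as P.
  assert (P2 : 0 < Cmod (1 + d)%C ^ 2) by now apply pow_lt.
  assert (Ed : Im d = 0).
  { apply Rmult_integral in B1; destruct B1 as [B1|B1]; [lra|].
    apply Rinv_0_lt_compat in P2; lra. }
  split; [exact Ed|].
  apply Rle_div_l in B2; [|exact P2].
  rewrite !Cmod2_alt in B2.
  assert (hd2 : 1 < Cmod d ^ 2) by nra; rewrite Cmod2_alt in hd2.
  destruct d as [s t]; simpl in *; subst t; nra.
- intros [Ed Hd1].
  assert (Q : (1 + Cmod d) / Cmod (1 + d)%C = 1).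
  { destruct d as [s t]; simpl in Ed, Hd1; subst t.
    change (s, 0) with (RtoC s); rewrite <- RtoC_plus, !Cmod_R, !Rabs_pos_eq by lra; field; lra. }
  destruct (op_norm_le (comp_op (linfrac q d)) (sqrt (/ q)) (sqrt_pos _)) as [r [Er [Pr Lr]]].
  { intros f; pose proof (comp_op_norm_le q d f hq hd Hr' hself) as B; rewrite Q in B; lra. }
  pose proof (ess_norm_comp_ge q d hq hd Hr' hself) as Lower.
  assert (Le : Rbar_le (ess_norm (comp_op (linfrac q d))) (Finite r)).
  { apply ess_norm_le with (1 := Pr) (2 := compact_zero); intros f.
    replace (plus _ _) with (comp_op (linfrac q d) f)
      by (symmetry; apply (plus_zero_r (G := H2_AbelianMonoid))).
    apply op_norm_bound; [exact Hom|]; rewrite Er; apply Rle_refl. }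
  rewrite Er; destruct (ess_norm (comp_op (linfrac q d))) as [e| |]; simpl in *; try contradiction.
  f_equal; lra.
Qed.
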